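(* There exists $\lambda_0>0$ such that for every $\lambda>\lambda_0$ there exist at least two distinct maximal hard-core Gibbs measures on $\mathcal{X}(\mathbb{A})$ with activity $\lambda$ (phase coexistence).
   Context: $\mathbb{A}$ is the triangular lattice $\{x\mathbf{b}_1+y\mathbf{b}_2:x,y\in\mathbb{Z}\}$, $\mathbf{b}_1=(1,0)$, $\mathbf{b}_2=(\tfrac12,\tfrac{\sqrt3}2)$, two sites adjacent iff at Euclidean distance $1$. $\mathcal{X}(\mathbb{A})$ is the set of $\omega\in\{0,1\}^{\mathbb{A}}$ whose support is a maximal independent set of $\mathbb{A}$. For finite $\Lambda\subset\mathbb{A}$, $\omega_\Lambda$ is the restriction, $|\omega_\Lambda|$ its number of $1$'s, $\Lambda^c=\mathbb{A}\setminus\Lambda$. A probability measure $\mu$ on $\mathcal{X}(\mathbb{A})$ is a maximal hard-core Gibbs measure with activity $\lambda>0$ if for every finite $\Lambda$, every $\eta\in\mathcal{X}(\mathbb{A})$ and $\mu$-a.e. $\omega$, $\mu_\Lambda(\eta\mid\omega)=\lambda^{|\eta_\Lambda|}/Z^\omega_{\Lambda,\lambda}$ if $\eta_{\Lambda^c}=\omega_{\Lambda^c}$ and $0$ otherwise, with $Z^\omega_{\Lambda,\lambda}=\sum_{\eta\in\mathcal{X}(\mathbb{A}):\eta_{\Lambda^c}=\omega_{\Lambda^c}}\lambda^{|\eta_\Lambda|}$. *)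

(* Defs.v *)
From HB Require Import structures.
From mathcomp Require Import all_boot all_order all_algebra finmap.
From mathcomp Require Import all_classical all_reals all_analysis.
From mathcomp Require Import zify ring lra.
Set Implicit Arguments.
Unset Strict Implicit.
Unset Printing Implicit Defensive.
Import Order.TTheory GRing.Theory Num.Theory.
Local Open Scope classical_set_scope.
Local Open Scope ring_scope.

(* The site x b1 + y b2 of the lattice is represented by its coordinates
   (x, y); its position in the plane is [pos]. *)
Definition site := (int * int)%type.

Section triangular_lattice.
Variable R : realType.

Definition b1 : 'rV[R]_2 := \row_i [:: 1; 0]`_i.
Definition b2 : 'rV[R]_2 := \row_i [:: 2^-1; Num.sqrt 3 / 2]`_i.
Definition pos (p : site) : 'rV[R]_2 := p.1%:~R *: b1 + p.2%:~R *: b2.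

(* The library norm on 'rV[R]_n is the sup norm, hence this definition. *)
Definition euclidean_dist (u v : 'rV[R]_2) : R :=
  Num.sqrt (\sum_i (u 0 i - v 0 i) ^+ 2).

Definition adjacent (p q : site) : Prop := euclidean_dist (pos p) (pos q) = 1.

Definition independent (S : set site) : Prop :=
  forall p q, S p -> S q -> ~ adjacent p q.

Definition maximal_independent (S : set site) : Prop :=
  independent S /\
  forall S', independent S' -> S `<=` S' -> S' = S.

Definition mis_configs : set (site -> bool) :=
  [set w | maximal_independent [set p | w p]].

Definition mis_config := set_type mis_configs.
HB.instance Definition _ := Choice.on mis_config.
Definition occupied (w : mis_config) : site -> bool := val w.

End triangular_lattice.

Section nonempty.
Variable R : realType.

Lemma adjacentE (p q : site) : adjacent R p q <->
  let a := p.1 - q.1 in let b := p.2 - q.2 in a ^+ 2 + a * b + b ^+ 2 = 1.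
Proof.
rewrite /adjacent /euclidean_dist big_ord_recl big_ord1 !mxE /=.
set S := (X in Num.sqrt X).
have -> : S = ((p.1 - q.1) ^+ 2 + (p.1 - q.1) * (p.2 - q.2)
             + (p.2 - q.2) ^+ 2)%:~R.
  have h3 : Num.sqrt (3 : R) ^+ 2 = 3 by rewrite sqr_sqrtr.
  rewrite /S !(intrD, intrM, rmorphB, rmorphXn) /=.
  transitivity ((p.1%:~R - q.1%:~R + (p.2%:~R - q.2%:~R) / 2) ^+ 2
     + (p.2%:~R - q.2%:~R) ^+ 2 / 4 * Num.sqrt (3 : R) ^+ 2); first by field.
  by rewrite h3; field.
move: (_ + _ + _) => z; split=> [h | ->]; last by rewrite sqrtr1.
have z0 : 0 <= (z%:~R : R).
  by rewrite leNgt; apply/negP => /ltW /ler0_sqrtr h0; move: h;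
     rewrite h0 => /eqP; rewrite eq_sym oner_eq0.
have : (z%:~R : R) = 1 by rewrite -(sqr_sqrtr z0) h expr1n.
by move=> /eqP; rewrite -[1]/(1%:~R) eqr_int => /eqP.
Qed.

Definition sublattice3 (p : site) : bool := (3 %| (p.1 - p.2)%R)%Z.

Lemma sublattice3_mis : mis_configs R sublattice3.
Proof.
split=> [[a b] [c d] | S' indS' sub].
- rewrite /= /sublattice3 /= => /dvdzP[k1 h1] /dvdzP[k2 h2] /adjacentE /=.
  have {h1 h2} : (a - c) - (b - d) = (k1 - k2) * 3 by lia.
  move: (a - c) (b - d) (k1 - k2) => u v k hk.
  have -> : u = v + k * 3 by lia.
  move=> e; have : 3 * (v ^+ 2 + v * 3 * k + 3 * k ^+ 2) = 1 :> int.
    by rewrite -[RHS]e; ring.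
  by move: (v ^+ 2 + v * 3 * k + 3 * k ^+ 2) => m; lia.
- apply/seteqP; split=> // -[a b] S'ab /=; apply/negPn/negP => nab.
  have [k [e he hk]] : exists k, exists2 e : int, (e = 1 \/ e = -1) & a - b + e = k * 3.
    move: nab; rewrite /sublattice3 /= => nab.
    have := divz_eq (a - b) 3; have := @modz_ge0 (a - b) 3 isT.
    have := @ltz_pmod (a - b) 3 isT.
    have : ((a - b) %% 3)%Z != 0 by apply: contra nab => /eqP/dvdz_mod0P.
    move: ((a - b) %/ 3)%Z ((a - b) %% 3)%Z => k r r0 r3 rge e.
    have [r1|r2] : r = 1 \/ r = 2 by lia.
    - by exists k, (-1); [right | lia].
    - by exists (k + 1), 1; [left | lia].
  apply: (indS' (a, b) (a + e, b) S'ab).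
    apply: sub; rewrite /= /sublattice3 /=; apply/dvdzP; exists k; lia.
  by apply/adjacentE => /=; case: he => ->; ring.
Qed.

(* Measurable types must be inhabited. *)
HB.instance Definition _ := isPointed.Build (mis_config R)
  (exist _ sublattice3 (mem_set sublattice3_mis)).

End nonempty.

Section gibbs.
Variable R : realType.
Implicit Types (w eta : mis_config R) (L : {fset site}).
Local Open Scope ereal_scope.

Definition coordinate_events (D : set site) : set (set (mis_config R)) :=
  [set B | exists2 p, D p & B = [set w | occupied w p]].

(* mis_config R with the sigma-algebra generated by the coordinates in D;
   D = setT gives the product sigma-algebra. *)
Definition configs_on (D : set site) :=
  g_sigma_algebraType (coordinate_events D).
HB.instance Definition _ D := Measurable.on (configs_on D).

Notation configs := (configs_on [set: site]).
Notation outside L := (~` [set` L]).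

Definition agree_outside L eta w : Prop :=
  forall p, p \notin L -> occupied eta p = occupied w p.

Lemma finite_agree_outside L w : finite_set [set eta | agree_outside L eta w].
Proof.
pose f eta : {fset site} := [fset p in L | occupied eta p]%fset.
have fin : finite_set (f @` [set eta | agree_outside L eta w]).
  apply: (@sub_finite_set _ _ [set` fpowerset L]) => // S [eta _ <-] /=.
  by rewrite fpowersetE; apply/fsubsetP => p; rewrite !inE => /andP[].
suff inj : {in [set eta | agree_outside L eta w] &, injective f}.
  by rewrite -(eq_finite_set (inj_card_eq inj)).
move=> eta1 eta2 /set_mem /= a1 /set_mem /= a2 e; apply/val_inj/funext => p.
have [pL|pL] := boolP (p \in L); last by rewrite [LHS]a1 // [RHS]a2.
by have := congr1 (fun S : {fset site} => p \in S) e; rewrite !inE pL.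
Qed.

Definition num_ones L eta : nat := #|` [fset p in L | occupied eta p]|%fset.

Definition partition_function (lambda : R) L w : R :=
  (\sum_(eta \in [set eta | agree_outside L eta w]) lambda ^+ num_ones L eta)%R.

(* k is a regular version of the conditional law of mu given the configuration
   outside L. *)
Definition conditional_law (mu : probability configs R) L
    (k : R.-pker configs_on (outside L) ~> configs) : Prop :=
  forall (A : set configs) (B : set (configs_on (outside L))),
    measurable A -> measurable B ->
    \int[mu]_(w in (B : set configs)) k w A = mu (A `&` B).

(* The null set is chosen before eta: for non-atomic mu, the condition for a
   single fixed eta would be void. *)
Definition maximal_hardcore_gibbs (lambda : R) (mu : probability configs R) :
    Prop :=
  forall L, exists2 k : R.-pker configs_on (outside L) ~> configs,
    conditional_law mu k &
    {ae mu, forall w : configs, forall eta : configs, k w [set eta] =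
      if `[< agree_outside L eta w >]
      then (lambda ^+ num_ones L eta / partition_function lambda L w)%R%:E
      else 0}.

End gibbs.

Notation configs R := (configs_on R [set: site]).

(* Main.v *)
Require Import Defs.
From mathcomp Require Import all_boot all_order all_algebra.
From mathcomp Require Import all_classical all_reals all_analysis.
From HB Require Import structures.
From mathcomp Require Import finmap measurable_realfun.
From mathcomp Require Import zify ring lra.
(** A maximal independent set occupies at most one vertex of each lattice
    triangle, and two full triangles sharing an edge have their occupied
    vertices in the same of the three classes of sites [x - y mod 3].  Since an
    occupied site fills six triangles, the weight of a configuration is
    [lambda ^ (- e / 6)] up to a constant, [e] being the number of empty
    triangles.  Take a component (contour) [g] of the set of empty triangles,
    where triangles sharing a vertex are neighbours.  The differences of the
    classes across [g] form a [Z/3]-cochain which is closed around every site,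
    hence the differential of a potential [f] that vanishes at infinity, is
    locally constant off [g] and gives the class near [g] up to a constant.
    Translating the triangles off [g] by one of three vectors according to [f],
    and filling what is left with a ground state, yields a maximal independent
    set with the same boundary condition and [#|g|] fewer empty triangles, from
    which the original can be recovered if [g] and the classes next to [g] are
    known.  The potentials of all contours add up to the class, so an empty or
    wrongly coloured triangle at the origin forces a contour around it, and the
    Peierls estimate follows by counting connected sets.

    Ultrafilter limits of the box measures on local events extend to a
    probability by compactness and the Caratheodory theorem; the conditional
    laws are checked on local events and extended by Dynkin's lemma. *)

Set Implicit Arguments.
Unset Strict Implicit.
Unset Printing Implicit Defensive.
Import Order.TTheory GRing.Theory Num.Theory.
Import numFieldNormedType.Exports.
Local Open Scope classical_set_scope.
Local Open Scope ring_scope.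

(** * Triangles and maximal independent sets *)

(* (x, y, true) is the triangle (x, y), (x + 1, y), (x, y + 1), and
   (x, y, false) its mirror image across the edge (x + 1, y), (x, y + 1). *)
Definition triangle := (int * int * bool)%type.

Definition vertices (T : triangle) : seq site :=
  let: (x, y, u) := T in
  [:: if u then (x, y) else (x + 1, y + 1); (x + 1, y); (x, y + 1)].

Definition star (p : site) : seq triangle :=
  let: (x, y) := p in
  [:: (x, y, true); (x - 1, y, false); (x - 1, y, true);
      (x - 1, y - 1, false); (x, y - 1, true); (x, y - 1, false)].

Lemma mem_star p T : (T \in star p) = (p \in vertices T).
Proof.
case: p T => [x y] [[x' y'] u]; rewrite /star /vertices !inE !xpair_eqE.
by case: u; rewrite /= ?xpair_eqE ?andbF ?andbT ?orbF; apply/idP/idP; lia.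
Qed.

(** The proper 3-colouring of the lattice; its colour classes are the three ground states. *)
Definition class (p : site) : 'Z_3 := (p.1 - p.2)%:~R.

Lemma Z3P (k : 'Z_3) : [\/ k = 0, k = 1 | k = -1].
Proof.
by case: k => [[|[|[|//]]] h]; [constructor 1|constructor 2|constructor 3];
   apply/val_inj.
Qed.

Lemma class_vertices x y (u : bool) :
  [/\ class (if u then (x, y) else (x + 1, y + 1)) = class (x, y),
      class (x + 1, y) = class (x, y) + 1 &
      class (x, y + 1) = class (x, y) - 1].
Proof.
split; rewrite /class.
- by case: u => //=; congr (_ %:~R); lia.
- by rewrite -[1 in RHS]/(1%:~R) -intrD /=; congr (_ %:~R); lia.
- by rewrite -[1 in RHS]/(1%:~R) -intrB /=; congr (_ %:~R); lia.
Qed.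

Lemma class_inj T p q : p \in vertices T -> q \in vertices T ->
  class p = class q -> p = q.
Proof.
case: T => [[x y] u]; have [E0 E1 E2] := class_vertices x y u; rewrite !inE.
by move=> /or3P[] /eqP -> /or3P[] /eqP ->; rewrite ?E0 ?E1 ?E2 //;
  case: (Z3P (class (x, y))) => ->.
Qed.

Lemma class_surj T k : exists2 p, p \in vertices T & class p = k.
Proof.
case: T => [[x y] u]; have [E0 E1 E2] := class_vertices x y u.
case: (Z3P (k - class (x, y))) => /eqP; rewrite subr_eq => /eqP ->.
- exists (if u then (x, y) else (x + 1, y + 1)); first by rewrite !inE eqxx.
  by rewrite E0 add0r.
- by exists (x + 1, y); rewrite ?inE ?eqxx ?orbT // E1 addrC.
- by exists (x, y + 1); rewrite ?inE ?eqxx ?orbT // E2 addrC.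
Qed.

(** In terms of triangles, [packed] is independence, and [covering] is maximality of a packed
    set. *)
Definition full (S : site -> bool) T := has S (vertices T).
Definition packed (S : site -> bool) := forall T p q,
  p \in vertices T -> q \in vertices T -> S p -> S q -> p = q.
Definition covering (S : site -> bool) := forall p,
  exists2 T, p \in vertices T & full S T.

Lemma norm1_offsets (a b : int) : a ^+ 2 + a * b + b ^+ 2 = 1 ->
  (a, b) \in [:: (1, 0); (-1, 0); (0, 1); (0, -1); (1, -1); (-1, 1)].
Proof.
move=> e.
(* Completing the square in either variable bounds both offsets by 1. *)
have e1 : (2 * a + b) ^+ 2 + 3 * b ^+ 2 = 4.
  by transitivity (4 * (a ^+ 2 + a * b + b ^+ 2)); [ring | rewrite e].
have e2 : (2 * b + a) ^+ 2 + 3 * a ^+ 2 = 4.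
  by transitivity (4 * (a ^+ 2 + a * b + b ^+ 2)); [ring | rewrite e].
have ha : -1 <= a <= 1 by nia.
have hb : -1 <= b <= 1 by nia.
have [ea|[ea|ea]] : a = -1 \/ a = 0 \/ a = 1 by lia.
all: have [eb|[eb|eb]] : b = -1 \/ b = 0 \/ b = 1 by lia.
all: by move: e; rewrite ea eb.
Qed.

Lemma adjacent_triangle (R : realType) p q : Defs.adjacent R p q <->
  p <> q /\ exists2 T, p \in vertices T & q \in vertices T.
Proof.
rewrite adjacentE; case: p q => [x y] [x' y'] /=; split.
  move=> /norm1_offsets; rewrite !inE !xpair_eqE => h.
  split; first by case=> ? ?; lia.
  case/or4P: h => [| | |/or3P[]] /andP[/eqP e1 /eqP e2].
  - exists (x', y', true); rewrite !inE !xpair_eqE; lia.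
  - exists (x' - 1, y', true); rewrite !inE !xpair_eqE; lia.
  - exists (x', y', true); rewrite !inE !xpair_eqE; lia.
  - exists (x', y' - 1, true); rewrite !inE !xpair_eqE; lia.
  - exists (x', y' - 1, true); rewrite !inE !xpair_eqE; lia.
  - exists (x' - 1, y', true); rewrite !inE !xpair_eqE; lia.
case=> ne [[[a b] u]]; rewrite !inE !xpair_eqE.
have {}ne : ~~ ((x == x') && (y == y')).
  by apply/negP => /andP[/eqP e1 /eqP e2]; apply: ne; rewrite e1 e2.
by case: u; rewrite !xpair_eqE => /or3P[] /andP[/eqP ? /eqP ?]
  /or3P[] /andP[/eqP ? /eqP ?]; subst; move: ne; rewrite ?eqxx ?andbT //= => _; ring.
Qed.

Lemma mis_packed (R : realType) S : mis_configs R S <-> packed S /\ covering S.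
Proof.
split=> [[ind max] | [pk cov]].
  have pk : packed S.
    move=> T p q pT qT Sp Sq; apply: contrapT => pq.
    by apply: (ind _ _ Sp Sq); apply/adjacent_triangle; split => //; exists T.
  split=> // p; apply: contrapT => ncov.
  have nS q T : p \in vertices T -> q \in vertices T -> ~ S q.
    move=> pT qT Sq; apply: ncov; exists T => //; apply/hasP; by exists q.
  have pp : p \in vertices (p, true) by case: (p) => ? ?; rewrite !inE eqxx.
  (* If no triangle at [p] is full, [p] can be added to [S], against maximality. *)
  have : [set q | S q \/ q = p]%classic = [set q | S q]%classic.
    apply: max => [q r | q]; last by left.
    move=> /= [Sq|->] [Sr|->] /adjacent_triangle[qr [T qT rT]].
    - by apply: qr; exact: (pk T).
    - exact: nS rT qT Sq.
    - exact: nS qT rT Sr.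
    - by [].
  move=> /seteqP[/(_ p) /= h _].
  by apply: (nS p (p, true)) => //; apply: h; right.
split.
  move=> p q Sp Sq /adjacent_triangle[pq [T pT qT]].
  by apply: pq; exact: (pk T).
move=> S' ind' sub; apply/seteqP; split => // p S'p.
have [T pT /hasP[q qT Sq]] := cov p.
have [->//|pq] := eqVneq p q.
case: (ind' p q S'p (sub _ Sq)); apply/adjacent_triangle.
by split; [exact/eqP | exists T].
Qed.

(* The class of the occupied vertex, with junk value 0 on empty triangles. *)
Definition tau (S : site -> bool) T : 'Z_3 :=
  \sum_(p <- vertices T | S p) class p.

Lemma vertices_uniq T : uniq (vertices T).
Proof.
case: T => [[x y] []]; rewrite /= !inE !xpair_eqE; lia.
Qed.

Lemma tau_occ S T p : packed S -> p \in vertices T -> S p -> tau S T = class p.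
Proof.
move=> pk pT Sp; rewrite /tau -big_filter (bigD1_seq p) /=; first last.
- by rewrite filter_uniq ?vertices_uniq.
- by rewrite mem_filter Sp.
rewrite big_seq_cond big1 ?addr0 // => q; rewrite mem_filter.
by move=> /andP[/andP[Sq qT] /eqP[]]; exact: (pk T).
Qed.

Lemma tau_empty S T : ~~ full S T -> tau S T = 0.
Proof.
move=> /hasPn h; rewrite /tau big_seq_cond big1 // => q /andP[/h /negP].
by [].
Qed.

Lemma occ_tau S T p : packed S -> full S T -> p \in vertices T ->
  S p = (class p == tau S T).
Proof.
move=> pk /hasP[q qT Sq] pT; rewrite (tau_occ pk qT Sq).
apply/idP/eqP => [Sp | /(class_inj pT qT) -> //]; congr class; exact: (pk T).
Qed.

(** The states of [p] and [q] decide whether [tau] is the class of [p], that of [q] or the third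
    one, and both triangles see these two states. *)
Lemma tau_edge S T T' p q : packed S -> p != q -> p \in vertices T ->
  q \in vertices T -> p \in vertices T' -> q \in vertices T' ->
  full S T -> full S T' -> tau S T = tau S T'.
Proof.
move=> pk pq pT qT pT' qT' fT fT'.
have e1 := occ_tau pk fT pT; have e2 := occ_tau pk fT' pT'.
have e3 := occ_tau pk fT qT; have e4 := occ_tau pk fT' qT'.
have : class p != class q by apply: contra_neq pq; apply: class_inj pT qT.
move: (esym e1) (esym e3); rewrite {}e2 {}e4.
case: (Z3P (class p)) => ->; case: (Z3P (class q)) => ->; case: (Z3P (tau S T)) => ->;
  case: (Z3P (tau S T')) => ->; by [].
Qed.

(** * The potential of a contour *)

(** Triangles with the same second coordinate form a row; [right_of] and [left_of] cross one edge
    along it, [abscissa] numbers it by consecutive integers, and [ray T] is its part from [T]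
    rightwards. *)
Definition right_of (T : triangle) : triangle :=
  let: (x, y, u) := T in if u then (x, y, false) else (x + 1, y, true).
Definition left_of (T : triangle) : triangle :=
  let: (x, y, u) := T in if u then (x - 1, y, false) else (x, y, true).
Definition abscissa (T : triangle) : int := 2 * T.1.1 + (~~ T.2)%:Z.
Definition ray (T T' : triangle) : bool :=
  (T'.1.2 == T.1.2) && (abscissa T <= abscissa T').
Definition touching (T T' : triangle) : bool :=
  has [in vertices T] (vertices T').

Lemma touchingP T T' :
  reflect (exists2 p, T \in star p & T' \in star p) (touching T T').
Proof.
apply: (iffP hasP) => -[p]; rewrite ?mem_star => h1 h2; exists p => //;
  by rewrite mem_star.
Qed.

Lemma touching_sym T T' : touching T T' = touching T' T.
Proof. by apply/touchingP/touchingP => -[p ? ?]; exists p. Qed.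

Lemma left_ofK : cancel left_of right_of.
Proof. by case=> [[x y] []]; rewrite /left_of /right_of ?subrK. Qed.

Lemma right_ofK : cancel right_of left_of.
Proof. by case=> [[x y] []]; rewrite /left_of /right_of ?addrK. Qed.

Lemma ray_right T T' : ray T T' = (T' == T) || ray (right_of T) T'.
Proof.
case: T T' => [[x y] u] [[x' y'] u']; rewrite /ray /abscissa !xpair_eqE /=.
by case: u; case: u' => /=; apply/idP/idP; lia.
Qed.

Lemma ray_rightN T : ray (right_of T) T = false.
Proof.
by case: T => [[x y] []]; rewrite /ray /abscissa /=; apply/negP => /andP[]; lia.
Qed.

Lemma tau_right S T : packed S -> full S T -> full S (right_of T) ->
  tau S T = tau S (right_of T).
Proof.
case: T => [[x y] []] pk.
  by apply: (@tau_edge S _ _ (x + 1, y) (x, y + 1) pk);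
    rewrite ?inE ?xpair_eqE ?eqxx ?orbT //=; lia.
by apply: (@tau_edge S _ _ (x + 1, y) (x + 1, y + 1) pk);
    rewrite ?inE ?xpair_eqE ?eqxx ?orbT //=; lia.
Qed.

Lemma tau_up S x y : packed S -> full S (x, y, false) ->
  full S (x, y + 1, true) -> tau S (x, y, false) = tau S (x, y + 1, true).
Proof.
move=> pk; apply: (@tau_edge S _ _ (x, y + 1) (x + 1, y + 1) pk);
  by rewrite ?inE ?xpair_eqE ?eqxx ?orbT //=; lia.
Qed.

Lemma triangles_bounded (g : {fset triangle}) : exists M : int,
  forall T, T \in g -> - M < T.1.1 < M /\ - M < T.1.2 < M.
Proof.
pose s (T : triangle) := (absz T.1.1 + absz T.1.2)%N.
exists (\sum_(T <- g) s T).+1%:Z => T Tg.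
have : (s T <= \sum_(T <- g) s T)%N.
  by rewrite (big_fsetD1 T) //= leq_addr.
by move: (\sum_(T <- g) s T)%N => n; case: T {Tg} => [[x y] u]; rewrite /s /=; lia.
Qed.

(** The six triangles around a site form a cycle, so five shared edges link them all. *)
Lemma star_const (h : triangle -> 'Z_3) x y :
  h (x, y, true) = h (x - 1, y, false) -> h (x - 1, y, false) = h (x - 1, y, true) ->
  h (x - 1, y, true) = h (x - 1, y - 1, false) ->
  h (x - 1, y - 1, false) = h (x, y - 1, true) ->
  h (x, y - 1, true) = h (x, y - 1, false) ->
  forall T, T \in star (x, y) -> h T = h (x, y, true).
Proof.
move=> e1 e2 e3 e4 e5 T; rewrite !inE.
by case/or4P=> [| | |/or3P[]] /eqP ->; rewrite ?e1 ?e2 ?e3 ?e4 ?e5.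
Qed.

Section potential.
Variables (S : site -> bool) (g F : {fset triangle}).
Hypothesis pk : packed S.
(** [F] contains the left triangle of every horizontal step with a nonzero jump, so cutting a ray
    down to this finite set loses nothing. *)
Hypothesis gF : forall T, T \in g -> (T \in F) && (left_of T \in F).
Hypothesis g_empty : forall T, T \in g -> ~~ full S T.
Hypothesis g_closed : forall T T', T \in g -> ~~ full S T' -> touching T T' ->
  T' \in g.

(* Around a site touched by [g] this is the differential of [tau] (adjacent full
   triangles have the same [tau]), around any other site it is 0; so it is
   closed, and [potential] integrates it along the ray to the right. *)
Definition jump T T' : 'Z_3 :=
  if (T \in g) || (T' \in g) then tau S T' - tau S T else 0.

Definition potential T : 'Z_3 :=
  - \sum_(T' <- F | ray T T') jump T' (right_of T').

Definition touched p := has [in g] (star p).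

Lemma potential_right T :
  potential (right_of T) = potential T + jump T (right_of T).
Proof.
rewrite /potential; have [TF|TF] := boolP (T \in F); last first.
  rewrite /jump; case: ifP => [/orP[|] /gF/andP[] | _].
  - by rewrite (negPf TF).
  - by rewrite right_ofK (negPf TF).
  rewrite addr0; congr (- _); rewrite [LHS]big_seq_cond [RHS]big_seq_cond.
  apply: eq_bigl => T'.
  rewrite [in RHS]ray_right; case: eqP => [->|//].
  by rewrite (negPf TF).
rewrite big_mkcond [X in _ = - X + _]big_mkcond /=.
rewrite (big_fsetD1 T) //= [X in _ = - X + _](big_fsetD1 T) //=.
rewrite ray_rightN ray_right eqxx /= add0r opprD addrAC addNr add0r.
congr (- _); apply: eq_big_seq => T'; rewrite !inE => /andP[nT _].
by rewrite [in RHS]ray_right (negPf nT).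
Qed.

Lemma touched_full p T : touched p -> T \in star p -> T \notin g -> full S T.
Proof.
move=> /hasP[T1 T1p T1g] Tp Tg; apply: contraNT Tg => fT.
by apply: g_closed T1g fT _; apply/touchingP; exists p.
Qed.

Lemma jump_right p T : T \in star p -> right_of T \in star p ->
  jump T (right_of T) = if touched p then tau S (right_of T) - tau S T else 0.
Proof.
move=> Tp Tp'; rewrite /jump; case: ifP => [/orP h|/norP[h h']].
  by case: ifP => // /negP[]; case: h => h; apply/hasP; [exists T | exists (right_of T)].
by case: ifP => // t; rewrite -(tau_right pk) ?subrr //; exact: (touched_full t).
Qed.

Lemma jump_up p x y : (x, y, false) \in star p -> (x, y + 1, true) \in star p ->
  jump (x, y, false) (x, y + 1, true) =
  if touched p then tau S (x, y + 1, true) - tau S (x, y, false) else 0.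
Proof.
move=> Tp Tp'; rewrite /jump; case: ifP => [/orP h|/norP[h h']].
  by case: ifP => // /negP[]; case: h => h; apply/hasP;
    [exists (x, y, false) | exists (x, y + 1, true)].
by case: ifP => // t; rewrite (tau_up pk) ?subrr //; exact: (touched_full t).
Qed.

Lemma potential_support T : potential T != 0 -> exists2 T', T' \in g & ray T T'.
Proof.
move=> h; apply: contrapT => n; move: h; rewrite /potential big1_seq ?oppr0 ?eqxx //.
move=> T' /andP[r T'F]; rewrite /jump; case: ifP => // /orP[h|h].
  by case: n; exists T'.
case: n; exists (right_of T') => //; move: r.
case: T {h T'F} T' => [[x y] u] [[x' y'] u']; rewrite /ray /abscissa /=.
by case: u; case: u' => /=; lia.
Qed.

Let defect x y : 'Z_3 := potential (x, y + 1, true) - potential (x, y, false)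
  - jump (x, y, false) (x, y + 1, true).

(** [defect] measures the failure of this identity. It is the same at [x] and [x + 1], because
    [jump] is closed around the site between the two vertical steps, and it vanishes far to the
    right. *)
Lemma potential_up x y :
  potential (x, y + 1, true) =
  potential (x, y, false) + jump (x, y, false) (x, y + 1, true).
Proof.
suff /eqP : defect x y = 0.
  by rewrite /defect subr_eq0 => /eqP <-; rewrite [RHS]addrC subrK.
have step x' : defect x' y = defect (x' + 1) y.
  have e1 := potential_right (x', y + 1, true).
  have e2 := potential_right (x', y + 1, false).
  have e3 := potential_right (x', y, false).
  have e4 := potential_right (x' + 1, y, true).
  pose p : site := (x' + 1, y + 1).
  have j1 : (x', y + 1, true) \in star p by rewrite mem_star !inE /= eqxx ?orbT.
  have j2 : (x', y + 1, false) \in star p by rewrite mem_star !inE /= eqxx ?orbT.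
  have j3 : (x' + 1, y + 1, true) \in star p by rewrite mem_star !inE /= eqxx ?orbT.
  have j4 : (x', y, false) \in star p by rewrite mem_star !inE /= eqxx ?orbT.
  have j5 : (x' + 1, y, true) \in star p by rewrite mem_star !inE /= eqxx ?orbT.
  have j6 : (x' + 1, y, false) \in star p by rewrite mem_star !inE /= eqxx ?orbT.
  move: e1 e2 e3 e4; rewrite !(@jump_right p) // /defect /=.
  rewrite !(@jump_up p) //=.
  by case: ifP => _ e1 e2 e3 e4; rewrite e2 e1 e4 e3; ring.
have [M hM] := triangles_bounded g.
have far x' y' u : M <= x' -> potential (x', y', u) = 0.
  move=> Mx; apply/eqP/negP => /negP/potential_support[[[a b] v] /hM[/= h _]].
  by rewrite /ray /abscissa /=; lia.
have defect0 x' : M <= x' -> defect x' y = 0.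
  move=> Mx; rewrite /defect !far //.
  by rewrite /jump; case: ifP; rewrite ?subrr //= => /orP[] /hM /= []; lia.
have stepn n : defect x y = defect (x + n%:Z) y.
  elim: n => [|n ->]; first by rewrite addr0.
  by rewrite step intS [1 + _]addrC addrA.
by rewrite (stepn (absz (M - x))) defect0 //; lia.
Qed.

(** Five edges of the star are crossed by [potential_right] or [potential_up]; on each, the jump is
    the difference of the subtracted terms. *)
Lemma potential_star p T T' : T \in star p -> T' \in star p ->
  potential T - (if touched p then tau S T else 0) =
  potential T' - (if touched p then tau S T' else 0).
Proof.
pose h T := potential T - (if touched p then tau S T else 0).
suff {T T'} H T : T \in star p -> h T = h (p, true).
  by move=> Tp T'p; rewrite -!/(h _) (H _ Tp) (H _ T'p).
case: p @h => x y h; apply: star_const; rewrite /h.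
- have := potential_right (x - 1, y, false); rewrite /= subrK => ->.
  have /= := @jump_right (x, y) (x - 1, y, false); rewrite subrK => ->.
  + by case: ifP => _; ring.
  + by rewrite !inE eqxx ?orbT.
  + by rewrite !inE eqxx ?orbT.
- rewrite (potential_right (x - 1, y, true)).
  rewrite (@jump_right (x, y) (x - 1, y, true)) /=.
  + by case: ifP => _; ring.
  + by rewrite !inE eqxx ?orbT.
  + by rewrite !inE eqxx ?orbT.
- have := potential_up (x - 1) (y - 1); rewrite subrK => ->.
  have /= := @jump_up (x, y) (x - 1) (y - 1); rewrite subrK => ->.
  + by case: ifP => _; ring.
  + by rewrite !inE eqxx ?orbT.
  + by rewrite !inE eqxx ?orbT.
- have := potential_right (x - 1, y - 1, false); rewrite /= subrK => ->.
  have /= := @jump_right (x, y) (x - 1, y - 1, false); rewrite subrK => ->.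
  + by case: ifP => _; ring.
  + by rewrite !inE eqxx ?orbT.
  + by rewrite !inE eqxx ?orbT.
- rewrite (potential_right (x, y - 1, true)).
  rewrite (@jump_right (x, y) (x, y - 1, true)) /=.
  + by case: ifP => _; ring.
  + by rewrite !inE eqxx ?orbT.
  + by rewrite !inE eqxx ?orbT.
Qed.

(** A triangle with no member of [g] to its left can escape leftwards and then upwards without
    meeting [g]; the potential is constant on the way and 0 above [g]. *)
Lemma potential_left_support T : potential T != 0 ->
  exists2 T', T' \in g & ray T' T.
Proof.
move=> h; apply: contrapT => n; move: h.
have [M hM] := triangles_bounded g.
have step T' : ray T' T -> potential T' = potential T ->
    ray (left_of T') T /\ potential (left_of T') = potential T.
  move=> r <-; have e := potential_right (left_of T'); rewrite left_ofK in e.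
  have r' : ray (left_of T') T.
    move: r; case: (T) (T') => [[x y] u] [[x' y'] u']; rewrite /ray /abscissa /=.
    by case: u; case: u' => /=; lia.
  split=> //; rewrite e /jump; case: ifP; rewrite ?addr0 // => /orP[] h; case: n.
  - by exists (left_of T').
  - by exists T'.
have [x [y [hr he]]] : exists x y, ray (x, y, false) T /\
    potential (x, y, false) = potential T.
  have rT : ray T T by rewrite /ray eqxx lexx.
  move: rT step {n}; case: T => [[x y] []] rT step.
  - by exists (x - 1), y; exact: (step (x, y, true)).
  - by exists x, y.
have stepn k : ray (x - k%:Z, y, false) T /\
    potential (x - k%:Z, y, false) = potential T.
  elim: k => [|k [h1 h2]]; first by rewrite subr0.
  have [h3 h4] := step _ h1 h2; have [h5 h6] := step _ h3 h4.
  by rewrite intS [1 + _]addrC opprD addrA.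
have [k hk] : exists k : nat, x - k%:Z <= - M.
  by exists (absz (x + M)); lia.
have [_ <-] := stepn k; move: (x - k%:Z) hk => {hr he stepn} x' hx'.
have up y' : potential (x', y', false) = potential (x', y' + 1, false).
  have far v z : (x', z, v) \notin g by apply/negP => /hM[/=]; lia.
  rewrite (potential_right (x', y' + 1, true)) potential_up /jump /=.
  by rewrite !(negPf (far _ _)) !addr0.
have upn j : potential (x', y, false) = potential (x', y + j%:Z, false).
  elim: j => [|j ->]; first by rewrite addr0.
  by rewrite up intS [1 + _]addrC addrA.
rewrite (upn (absz (M - y))) => /potential_support[[[a b] u] /hM[/= _ h]].
by rewrite /ray /=; lia.
Qed.

End potential.

(** * Erasing a contour *)

(* Any two of the three vectors are adjacent sites. *)
Definition phase_shift (k : 'Z_3) : site :=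
  if k == 0 then (0, 0) else if k == 1 then (-1, 0) else (0, -1).

Definition translate (o : site) (T : triangle) : triangle :=
  (T.1.1 + o.1, T.1.2 + o.2, T.2).

Lemma translateNK o : cancel (translate (- o)) (translate o).
Proof. by case=> [[x y] u]; rewrite /translate /= !subrK. Qed.

Lemma vertices_translate o T :
  vertices (translate o T) = [seq p + o | p <- vertices T].
Proof.
case: T o => [[x y] u] [a b]; rewrite /translate /=.
have E (x1 y1 : int) : ((x1, y1) : site) + (a, b) = (x1 + a, y1 + b) by [].
case: u; rewrite !E; congr [:: _; _; _];
  by rewrite ?[_ + a + 1]addrAC ?[_ + b + 1]addrAC.
Qed.

Lemma mem_vertices_translate o T p :
  (p + o \in vertices (translate o T)) = (p \in vertices T).
Proof. by rewrite vertices_translate (mem_map (@addIr _ o)). Qed.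

Lemma classD p q : class (p + q) = class p + class q.
Proof.
by rewrite /class -intrD; congr (_ %:~R); case: p q => [? ?] [? ?] /=; ring.
Qed.

(** This sign sends a site of class [k + a] to class [a], so that the moved pieces match the ground
    state [a] along the contour. *)
Lemma class_shift k : class (phase_shift k) = - k.
Proof. by rewrite /class /phase_shift; case: (Z3P k) => -> /=; apply/val_inj. Qed.

(** All possible sources of [v] lie in the one triangle [(v, true)], where competing phases can be
    compared. *)
Lemma unshift_vertex v k : v - phase_shift k \in vertices (v, true).
Proof.
case: v => x y; rewrite /phase_shift.
by case: (Z3P k) => -> /=; rewrite !inE !xpair_eqE /=; lia.
Qed.

Section surgery.
Variables (S : site -> bool) (g : {fset triangle}) (f : triangle -> 'Z_3).
Variable a : 'Z_3.
Hypothesis pk : packed S.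
Hypothesis cov : covering S.
Hypothesis g_empty : forall T, T \in g -> ~~ full S T.
Hypothesis g_closed : forall T T', T \in g -> ~~ full S T' -> touching T T' ->
  T' \in g.
Hypothesis f_touched : forall p T, touched g p -> T \in star p ->
  tau S T = f T + a.
Hypothesis f_untouched : forall p T T', ~~ touched g p -> T \in star p ->
  T' \in star p -> f T = f T'.

(* The pieces of the complement of [g] where [f = k] move by [phase_shift k]; the
   sites not reached by the interior of a piece take the ground state [a], with
   which the moved pieces agree along [g]. *)
Definition active v k : bool :=
  ~~ touched g (v - phase_shift k) && (f (v - phase_shift k, true) == k).

Definition surgery v : bool :=
  if [pick k | active v k] is Some k then S (v - phase_shift k) else class v == a.

Lemma up_star p : (p, true) \in star p.
Proof. by case: p => x y; rewrite !inE eqxx. Qed.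

Lemma active_up v k : active v k -> f (v, true) = k /\ (v, true) \notin g.
Proof.
case/andP=> nt /eqP e.
have h : (v, true) \in star (v - phase_shift k) by rewrite mem_star unshift_vertex.
split; first by rewrite (f_untouched nt h (up_star _)).
by apply: contra nt => vg; apply/hasP; exists (v, true).
Qed.

Lemma active_inj v k k' : active v k -> active v k' -> k = k'.
Proof. by move=> /active_up[<- _] /active_up[<- _]. Qed.

(** If [p] is untouched, its phase is the only active one at the target [v]. If [p] is touched, its
    state is [class v == a], which is also what every other rule at [v] gives. *)
Lemma surgery_shift T p : T \notin g -> p \in vertices T ->
  surgery (p + phase_shift (f T)) = S p.
Proof.
move=> Tg pT; rewrite /surgery; set v := p + _.
have ev : v - phase_shift (f T) = p by rewrite addrK.
have [t|nt] := boolP (touched g p); last first.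
  have av : active v (f T).
    rewrite /active ev nt; apply/eqP; apply: (f_untouched nt (up_star _)).
    by rewrite mem_star.
  case: pickP => [k ak|/(_ (f T))]; last by rewrite av.
  by rewrite (active_inj ak av) ev.
have cls k : class (v - phase_shift k) == k + a = (class v == a).
  have := classD (v - phase_shift k) (phase_shift k); rewrite subrK class_shift => ->.
  by rewrite subr_eq [a + k]addrC.
have Tp : T \in star p by rewrite mem_star.
have -> : S p = (class v == a).
  rewrite (occ_tau pk (touched_full g_closed t Tp Tg) pT).
  by rewrite (f_touched t Tp) -(cls (f T)) ev.
case: pickP => // k ak.
(* Another phase [k] is active at [v]; the triangle [(v, true)] is in the star of [p], off [g] and
   hence full, with class [k + a]. *)
have [fk vg] := active_up ak.
have vp : (v, true) \in star p by rewrite mem_star -ev unshift_vertex.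
rewrite (occ_tau pk (touched_full g_closed t vp vg) (unshift_vertex _ _)).
by rewrite (f_touched t vp) fk cls.
Qed.

(** A vertex of [R] with an active phase has an untouched source, so all of [R] comes from one
    triangle off [g] in that phase. *)
Lemma surgery_cases R :
  (exists2 T, T \notin g & R = translate (phase_shift (f T)) T) \/
  (forall v, v \in vertices R -> surgery v = (class v == a)).
Proof.
apply: contrapT => /not_orP[nT]; apply=> v vR; rewrite /surgery.
case: pickP => // k /andP[nt /eqP fk]; case: nT.
pose T := translate (- phase_shift k) R.
have Tp : T \in star (v - phase_shift k) by rewrite mem_star mem_vertices_translate.
exists T; first by apply: contra nt => Tg; apply/hasP; exists T.
by rewrite (f_untouched nt Tp (up_star _)) fk translateNK.
Qed.

Lemma full_surgery T : T \notin g ->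
  full surgery (translate (phase_shift (f T)) T) = full S T.
Proof.
move=> Tg; rewrite /full vertices_translate has_map; apply: eq_in_has => p pT /=.
exact: surgery_shift.
Qed.

Lemma full_class R : (forall v, v \in vertices R -> surgery v = (class v == a)) ->
  full surgery R.
Proof.
move=> h; have [v vR ev] := class_surj R a.
by apply/hasP; exists v => //; rewrite h // ev.
Qed.

Lemma surgery_packed : packed surgery.
Proof.
move=> R p q pR qR; have [[T Tg RT]|h] := surgery_cases R; last first.
  by rewrite !h // => /eqP ep /eqP eq; apply: (class_inj pR qR); rewrite ep.
move: pR qR; rewrite RT vertices_translate => /mapP[p' p'T ->] /mapP[q' q'T ->].
by rewrite !surgery_shift // => Sp Sq; rewrite (pk p'T q'T).
Qed.

(** Ground-state triangles are full, so an empty one must be a moved triangle. This is why the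
    triangles of [g] disappear from the count of empty ones. *)
Lemma surgery_empty R : ~~ full surgery R ->
  exists T, [/\ T \notin g, ~~ full S T & R = translate (phase_shift (f T)) T].
Proof.
move=> nR; have [[T Tg RT]|/full_class] := surgery_cases R; last by rewrite (negPf nR).
by exists T; split=> //; rewrite -full_surgery // -RT.
Qed.

(** If [(v, true)] is empty, it is a moved empty triangle, so the source of [v] is untouched; a full
    triangle covering that source lies in the same piece and moves along with it. *)
Lemma surgery_covering : covering surgery.
Proof.
move=> v; have [fv|/surgery_empty[T [Tg nT e]]] := boolP (full surgery (v, true)).
  by exists (v, true) => //; rewrite -mem_star up_star.
have vT : v - phase_shift (f T) \in vertices T.
  by rewrite -(mem_vertices_translate (phase_shift (f T))) subrK -e -mem_star up_star.
have nt : ~~ touched g (v - phase_shift (f T)).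
  apply: contra Tg => t; apply/negPn/negP => Tg.
  by move: nT; rewrite (touched_full g_closed t _ Tg) // mem_star.
have [T' vT' fT'] := cov (v - phase_shift (f T)).
have T'g : T' \notin g by apply: contraL fT' => /g_empty.
exists (translate (phase_shift (f T')) T'); last by rewrite full_surgery.
rewrite (f_untouched nt (_ : T' \in _) (_ : T \in _)) ?mem_star //.
by rewrite -[v](subrK (phase_shift (f T))) mem_vertices_translate.
Qed.

(** The right side involves only [g], [f] and the new configuration, hence surgery is injective once
    these two are fixed. Triangles at an occupied site are full and so off [g]. *)
Lemma surgery_recover p :
  S p = has (fun T => (T \notin g) && surgery (p + phase_shift (f T))) (star p).
Proof.
apply/idP/hasP => [Sp | [T]]; last first.
  by rewrite mem_star => pT /andP[Tg]; rewrite surgery_shift.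
have pT : p \in vertices (p, true) by rewrite -mem_star up_star.
have Tg : (p, true) \notin g.
  by apply/negP => /g_empty /hasP; apply; exists p.
by exists (p, true); rewrite ?up_star // Tg surgery_shift.
Qed.

End surgery.

(** * Connected components of the set of empty triangles *)

Inductive linked (E : {fset triangle}) (T : triangle) : triangle -> Prop :=
| linked_refl : linked E T T
| linked_step A B : linked E T A -> B \in E -> touching A B -> linked E T B.

Definition contour (E : {fset triangle}) T : {fset triangle} :=
  [fset A in E | `[< linked E T A >]]%fset.

(** Connectedness as an induction principle: a property passed on between touching members spreads
    over [g]. *)
Definition vertex_connected (g : {fset triangle}) := forall T (P : triangle -> Prop),
  T \in g -> P T ->
  (forall A B, A \in g -> B \in g -> P A -> touching A B -> P B) ->
  forall A, A \in g -> P A.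

Section contours.
Variable E : {fset triangle}.

Lemma in_contour T A : (A \in contour E T) = (A \in E) && `[< linked E T A >].
Proof. by rewrite !inE. Qed.

Lemma contour_self T : T \in E -> T \in contour E T.
Proof. by move=> TE; rewrite in_contour TE; apply/asboolP; constructor. Qed.

Lemma contour_closed T A B : A \in contour E T -> B \in E -> touching A B ->
  B \in contour E T.
Proof.
rewrite !in_contour => /andP[_ /asboolP l] BE AB; rewrite BE.
by apply/asboolP; apply: linked_step l BE AB.
Qed.

Lemma linked_trans X Y Z : linked E X Y -> linked E Y Z -> linked E X Z.
Proof.
by move=> lXY; elim=> // A B _ ? ? ?; apply: linked_step; eassumption.
Qed.

Lemma linked_sym T A : T \in E -> linked E T A -> linked E A T.
Proof.
move=> TE; elim=> [|B C l IH CE BC]; first by constructor.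
have BE : B \in E by case: l.
by apply: linked_trans IH; apply: linked_step BE _; [constructor | rewrite touching_sym].
Qed.

Lemma contour_eq T A : T \in E -> A \in contour E T -> contour E A = contour E T.
Proof.
rewrite in_contour => TE /andP[AE /asboolP lA]; apply/fsetP => B; rewrite !in_contour.
congr (_ && _); apply/asboolP/asboolP; apply: linked_trans => //.
exact: linked_sym.
Qed.

Lemma contour_connected T : T \in E -> vertex_connected (contour E T).
Proof.
move=> TE X P XT PX step A AT; rewrite -(contour_eq TE XT) in AT step *.
move: AT; rewrite in_contour => /andP[AE /asboolP l].
elim: l AE => // B C l IH CE BC _.
have XE : X \in E by move: XT; rewrite in_contour => /andP[].
have BX : B \in contour E X.
  rewrite in_contour; apply/andP; split; first by case: l.
  exact/asboolP.
apply: (step B C BX (contour_closed BX CE BC) _ BC).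
by apply: IH; move: BX; rewrite in_contour => /andP[].
Qed.

End contours.

(** * Recovering the class from the potentials of all contours *)

Section outline.
Variables (S : site -> bool) (E F : {fset triangle}).
Hypothesis pk : packed S.
Hypothesis E_empty : forall T, (T \in E) = ~~ full S T.
Hypothesis EF : forall T, T \in E -> (T \in F) && (left_of T \in F).

Let contours : {fset {fset triangle}} := [fset contour E T | T in E]%fset.

(** If exactly one of the two triangles is empty, only its contour contributes; if both are empty,
    all values are 0; if both are full, [tau] agrees across the edge. *)
Let sum_jump T : \sum_(g <- contours) jump S g T (right_of T) =
  tau S (right_of T) - tau S T.
Proof.
have out A g : A \in E -> g \in contours -> A \in g -> g = contour E A.
  move=> AE /imfsetP[B /= BE ->] AB; by rewrite (contour_eq BE AB).
have zero g : g \in contours -> forall A, A \in g -> A \in E.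
  by move=> /imfsetP[B /= BE ->] A; rewrite in_contour => /andP[].
have one A : A \in E -> forall g, g \in contours -> g != contour E A -> A \notin g.
  by move=> AE g gc; apply: contra => /(out _ _ AE gc) ->.
have cl A : A \in E -> contour E A \in contours.
  by move=> AE; apply/imfsetP; exists A.
have notin g A : g \in contours -> A \notin E -> A \notin g.
  by move=> gc; apply: contra; apply: zero.
have [TE|TE] := boolP (T \in E); have [TE'|TE'] := boolP (right_of T \in E).
- have e A : A \in E -> tau S A = 0 by rewrite E_empty; apply: tau_empty.
  by rewrite !e // subrr big1 // => g _; rewrite /jump !e // subrr if_same.
- rewrite (big_fsetD1 _ (cl _ TE)) /= {1}/jump contour_self //= big1_seq ?addr0 //.
  move=> g; rewrite in_fsetD1 => /andP[_ /andP[ng gc]].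
  by rewrite /jump (negPf (one _ TE g gc ng)) (negPf (notin _ _ gc TE')).
- rewrite (big_fsetD1 _ (cl _ TE')) /= {1}/jump contour_self // orbT.
  rewrite big1_seq ?addr0 // => g; rewrite in_fsetD1 => /andP[_ /andP[ng gc]].
  by rewrite /jump (negPf (one _ TE' g gc ng)) (negPf (notin _ _ gc TE)).
- rewrite big1_seq; last first.
    by move=> g /andP[_ gc]; rewrite /jump !(negPf (notin _ _ gc _)).
  by rewrite -(tau_right pk) ?subrr //; apply/negPn; rewrite -E_empty.
Qed.

(* The potentials of all contours add up to [tau] minus its value at infinity. *)
Lemma tau_ray_constant T :
  (forall A, A \in E -> potential S (contour E A) F T = 0) ->
  exists N, forall k, (N <= k)%N -> tau S (iter k right_of T) = tau S T.
Proof.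
move=> h0.
pose D A := \sum_(g <- contours) potential S g F A.
have gF g : g \in contours -> forall A, A \in g -> (A \in F) && (left_of A \in F).
  by move=> /imfsetP[B /= BE ->] A; rewrite in_contour => /andP[AE _]; exact: EF.
have step A : D (right_of A) = D A + (tau S (right_of A) - tau S A).
  rewrite -sum_jump -big_split; apply: eq_big_seq => g gc.
  by rewrite (potential_right S (gF g gc)).
(* The difference of [D] and [tau] is conserved along the row, and [D T] is 0 by [h0]. *)
have iterD k : D (iter k right_of T) - tau S (iter k right_of T) = - tau S T.
  elim: k => [|k IH]; last by rewrite iterS step -IH; ring.
  rewrite /D big1_seq ?sub0r // => g /andP[_ /imfsetP[B /= BE ->]]; exact: h0.
have [M hM] := triangles_bounded F.
have ab k : abscissa (iter k right_of T) = abscissa T + k%:Z.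
  elim: k => [|k IH]; first by rewrite addr0.
  rewrite iterS intS addrCA -IH; case: (iter _ _ _) => [[x y] []];
    rewrite /abscissa /=; lia.
(* Beyond this point the ray leaves [F], so [D] is 0 there as well. *)
exists (absz (2 * M + 2 - abscissa T)%R) => k kM.
have := iterD k; rewrite /D big1_seq ?sub0r => [/oppr_inj //|].
move=> g /andP[_ gc]; rewrite /potential big1_seq ?oppr0 // => T' /andP[r T'F].
move: r; rewrite /ray ab; have [h _] := hM _ T'F.
rewrite {2}/abscissa; move: h kM; case: T' {T'F} => [[x y] u] /=.
by case: u => /=; lia.
Qed.

End outline.

(** * Counting contours *)

Lemma touching_refl T : touching T T.
Proof.
case: T => [[x y] u]; apply/touchingP; exists (x + 1, y);
  by rewrite mem_star !inE eqxx orbT.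
Qed.

Lemma in_fset_seq (l : seq triangle) T : (T \in [fset A in l]%fset) = (T \in l).
Proof. by rewrite !inE. Qed.

(* A connected set of [n] triangles is the support of a walk with [2 (n - 1)]
   steps: each new triangle is inserted as a detour. *)
Lemma connected_walk (g : {fset triangle}) s k : vertex_connected g -> s \in g ->
  (k < #|` g|)%N -> exists p : seq triangle,
    [/\ size p = k.*2, path touching s p, {subset s :: p <= g} &
        (k < #|` [fset T in s :: p]%fset|)%N].
Proof.
move=> cg sg; elim: k => [|k IH] kg.
  exists [::]; split=> // [T|]; first by rewrite inE => /eqP ->.
  by rewrite cardfs_gt0; apply/fset0Pn; exists s; rewrite !inE eqxx.
have [p [sp pp pg kp]] := IH (ltnW kg).
have [gp|ngp] := boolP (g `<=` [fset T in s :: p])%fset.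
  (* All of [g] is visited already; the walk is padded by two idle steps. *)
  exists (p ++ [:: last s p; last s p]); split.
  - by rewrite size_cat sp /= addn2 doubleS.
  - by rewrite cat_path pp /= touching_refl.
  - move=> T; rewrite -cat_cons mem_cat => /orP[/pg //|].
    by rewrite !inE orbb => /eqP ->; apply: pg; apply: mem_last.
  - apply: leq_trans kg _; apply: fsubset_leq_card; apply: fsubset_trans gp _.
    by apply/fsubsetP => T; rewrite !in_fset_seq -cat_cons mem_cat => ->.
have [A [B [Ap Bg Bp AB]]] : exists A B,
    [/\ A \in s :: p, B \in g, B \notin s :: p & touching A B].
  apply: contrapT => n; move/negP: ngp; apply; apply/fsubsetP => T Tg.
  rewrite in_fset_seq; apply: (cg s (fun T => T \in s :: p)) (Tg) => //.
    by rewrite inE eqxx.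
  move=> A B Ag Bg Ap AB; apply: contrapT => /negP Bp; apply: n.
  by exists A, B.
(* The detour from [A] to [B] and back is inserted at an occurrence of [A], which may be the
   start. *)
have [q [sq pq Pq]] : exists q, [/\ size q = (size p).+2, path touching s q &
    s :: q =i B :: s :: p].
  move: Ap; rewrite inE => /predU1P[As|].
    exists (B :: s :: p); split=> //=; first by rewrite pp -As AB touching_sym AB.
    by move=> T; rewrite !inE; case: (T == s) => //=; rewrite orbT.
  move=> Ap; have [p1 [p2 ep]] : exists p1 p2, p = p1 ++ A :: p2.
    by case/splitPr: Ap => p1 p2; exists p1, p2.
  exists (p1 ++ [:: A, B, A & p2]); split.
  - by rewrite ep !size_cat /= !addnS.
  - move: pp; rewrite ep !cat_path /= => /and3P[-> -> ->].
    by rewrite AB touching_sym AB.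
  - move=> T; rewrite ep !(inE, mem_cat).
    by case: (T == s); case: (T \in p1); case: (T == A); case: (T == B).
exists q; split=> //.
- by rewrite sq sp.
- by move=> T; rewrite Pq inE => /predU1P[-> //|/pg].
have -> : [fset T in s :: q]%fset = (B |` [fset T in s :: p])%fset.
  by apply/fsetP => T; rewrite in_fset1U !in_fset_seq [LHS]Pq inE.
by rewrite cardfsU1 in_fset_seq Bp add1n ltnS.
Qed.

(** First coordinates of touching triangles differ by at most 1, so every value from 0 to [T'.1.1]
    is taken in [g]. *)
Lemma connected_span (g : {fset triangle}) T T' : vertex_connected g -> T \in g ->
  T' \in g -> T.1.1 <= 0 -> 0 <= T'.1.1 -> (absz T'.1.1 < #|` g|)%N.
Proof.
move=> cg Tg T'g T0 T'0.
have hit (i : nat) : (i <= absz T'.1.1)%N -> exists2 A, A \in g & A.1.1 = i%:Z.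
  move=> iT'; apply: contrapT => n.
  suff : T'.1.1 < i%:Z by lia.
  apply: (cg T (fun A => A.1.1 < i%:Z)) T'g => //.
    rewrite lt_neqAle (le_trans T0) // andbT; apply/eqP => e; apply: n.
    by exists T.
  move=> A B Ag Bg Ai /touchingP[[x y]]; rewrite !mem_star => pA pB.
  rewrite lt_neqAle; apply/andP; split.
    by apply/eqP => e; apply: n; exists B.
  move: pA pB Ai; case: A {Ag} => [[a b] u]; case: B {Bg} => [[a' b'] u'].
  by rewrite !inE !xpair_eqE /=; case: u; case: u' => /=; rewrite !xpair_eqE; lia.
have u : uniq [seq i%:Z | i <- iota 0 (absz T'.1.1).+1].
  by rewrite map_inj_uniq ?iota_uniq // => i j [].
have := uniq_leq_size u (s2 := [seq A.1.1 | A : triangle <- g]).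
rewrite !size_map size_iota cardfE; apply.
move=> z /mapP[i]; rewrite mem_iota ltnS => /= /hit[A Ag <-] ->.
by apply/mapP; exists A.
Qed.

Definition neighbours T : seq triangle := [seq T' | p <- vertices T, T' <- star p].

Lemma touching_neighbours T T' : touching T T' -> T' \in neighbours T.
Proof.
by move=> /touchingP[p pT pT']; apply/allpairsPdep; exists p, T'; rewrite -mem_star.
Qed.

(** Three vertices with six triangles each, counted with repetition. *)
Lemma size_neighbours T : size (neighbours T) = 18%N.
Proof. by case: T => [[x y] []]. Qed.

Fixpoint walks m T : seq (seq triangle) :=
  if m is m'.+1 then [seq A :: p | A <- neighbours T, p <- walks m' A]
  else [:: [::]].

Lemma size_walks m T : size (walks m T) = (18 ^ m)%N.
Proof.
elim: m T => //= m IH T; rewrite size_allpairs_dep.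
have E l : [seq size (walks m A) | A <- l] = nseq (size l) (18 ^ m)%N.
  by elim: l => //= A l ->; rewrite IH.
by rewrite E size_neighbours sumn_nseq expnSr.
Qed.

Lemma mem_walks T p : path touching T p -> p \in walks (size p) T.
Proof.
elim: p T => //= A p IH T /andP[TA /IH pA].
by apply/allpairsPdep; exists A, p; split=> //; apply: touching_neighbours.
Qed.

(* A contour around the origin meets the row of the origin on both sides, hence
   within a distance smaller than its size. *)
Definition starts n : seq triangle :=
  [seq (i%:Z, 0, u) | i <- iota 0 n, u <- [:: true; false]].

Definition labels n : seq (seq ('Z_3 * 'Z_3)) :=
  [seq tval t | t <- enum {: n.-tuple ('Z_3 * 'Z_3)}].

(** The length [n.-1.*2] is that of a walk covering [n] connected triangles; walks with smaller
    support are included too. *)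
Definition supports n : seq {fset triangle} :=
  [seq [fset T in s :: p]%fset | s <- starts n, p <- walks n.-1.*2 s].

(** Candidates for a contour of [n] triangles paired with the classes seen on its two sides. *)
Definition codes n := [seq (g, d) | g <- supports n, d <- labels n].

Lemma size_codes : exists K : nat, forall n, (size (codes n) <= K ^ n)%N.
Proof.
(* The factors bound the [2 * n] starts by [4 ^ n], the walks by [18 ^ (2 * n)] and the labels by
   [9 ^ n]. *)
exists (4 * (18 ^ 2 * 9))%N => n.
rewrite size_allpairs /supports size_allpairs_dep size_map -cardE card_tuple.
rewrite card_prod card_ord (expnMn 4) (expnMn (18 ^ 2)) -expnM mulnA leq_mul //.
have E l : [seq size (walks n.-1.*2 s) | s <- l] = nseq (size l) (18 ^ n.-1.*2)%N.
  by elim: l => //= s l ->; rewrite size_walks.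
rewrite E sumn_nseq size_allpairs size_iota mulnC leq_mul //.
  elim: n {E} => // n /= IH; rewrite expnS.
  have : (0 < 4 ^ n)%N by rewrite expn_gt0.
  by lia.
by rewrite leq_pexp2l // mul2n leq_double leq_pred.
Qed.

(** The walk starts at [T'], which [connected_span] places among the first [#|g|] columns; with
    [k = #|g| - 1] it must visit all of [g]. *)
Lemma mem_codes (g : {fset triangle}) T T' d : vertex_connected g ->
  T \in g -> T' \in g -> T.1.1 <= 0 -> 0 <= T'.1.1 -> T'.1.2 = 0 ->
  size d = #|` g| -> (g, d) \in codes #|` g|.
Proof.
move=> cg Tg T'g T0 T'0 T'y sd.
have g0 : (0 < #|` g|)%N by rewrite cardfs_gt0; apply/fset0Pn; exists T.
apply/allpairsP; exists (g, d); split=> //=; last first.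
  by apply/mapP; exists (tcast sd (in_tuple d)); rewrite ?mem_enum ?val_tcast.
have [|p [sp pp pg cp]] := connected_walk (k := #|` g|.-1) cg T'g.
  by rewrite prednK.
apply/allpairsPdep; exists T', p; split.
- apply/allpairsP; exists (absz T'.1.1, T'.2); split=> /=.
  + by rewrite mem_iota (connected_span cg Tg).
  + by case: T'.2; rewrite !inE.
  + by move: T0 T'0 T'y {Tg T'g pp cp pg}; case: T' => [[x y] u] /= _; case: x => // x _ ->.
- by rewrite -sp mem_walks.
- apply/eqP; rewrite eq_sym eqEfcard; apply/andP; split.
    by apply/fsubsetP => A; rewrite in_fset_seq; apply: pg.
  by rewrite -(prednK g0).
Qed.

(** * The Peierls bound in a box *)

Definition interval (n : nat) : {fset int} :=
  [fset x in [seq (i%:Z - n%:Z)%R | i <- iota 0 n.*2.+1]]%fset.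
Definition box (n : nat) : {fset site} :=
  (interval n `*` interval n)%fset.
Definition triangle_box (n : nat) : {fset triangle} :=
  (box n `*` [fset true; false])%fset.

Lemma in_interval n x : (x \in interval n) = (- n%:Z <= x <= n%:Z).
Proof.
rewrite in_fset; apply/mapP/idP => [[i]|h].
  by rewrite mem_iota => h ->; lia.
by exists (absz (x + n%:Z)); rewrite ?mem_iota; lia.
Qed.

Lemma in_box n (x y : int) :
  ((x, y) \in box n) = (- n%:Z <= x <= n%:Z) && (- n%:Z <= y <= n%:Z).
Proof.
by rewrite in_fsetM !in_interval.
Qed.

Lemma in_triangle_box n p u : ((p, u) \in triangle_box n) = (p \in box n).
Proof.
by rewrite in_fsetM; case: u; rewrite !inE andbT.
Qed.

Lemma sum_triangle_box n (h : triangle -> int) :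
  \sum_(T <- triangle_box n) h T =
  \sum_(p <- box n) (h (p, true) + h (p, false)).
Proof.
rewrite big_imfset2 /=; last by move=> [p u] [q v] _ _ [-> ->].
by apply: eq_bigr => p _; rewrite big_fsetU1 ?inE //= big_seq_fset1.
Qed.

Lemma sum_box_shift (h : site -> int) n (o : site) :
  -1 <= o.1 <= 1 -> -1 <= o.2 <= 1 -> (forall p, p \notin box n -> h p = 0) ->
  \sum_(p <- box n.+1) h (p + o) = \sum_(p <- box n) h p.
Proof.
move=> o1 o2 h0.
transitivity (\sum_(q <- [fset p - o | p in box n]%fset) h (q + o)); last first.
  rewrite big_imfset /=; first by apply: eq_bigr => p _; rewrite subrK.
  by move=> p q _ _; exact: addIr.
apply/esym/big_fset_incl.
  apply/fsubsetP => q /imfsetP[[x y] /=]; rewrite in_box => xy ->.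
  by move: o o1 o2 => [a b] /= o1 o2 in xy *; rewrite in_box /=; lia.
move=> q _ qn; apply: h0; apply: contra qn => qo; apply/imfsetP => /=.
by exists (q + o); rewrite ?addrK.
Qed.

Lemma full_count S T : packed S ->
  (full S T)%:Z = \sum_(p <- vertices T) (S p)%:Z.
Proof.
move=> pk; have [/hasP[p pT Sp]|/hasPn nS] := boolP (full S T).
  rewrite (bigD1_seq p) ?vertices_uniq //= Sp big_seq_cond big1 ?addr0 //.
  move=> q /andP[qT qp]; case Sq: (S q) => //.
  by rewrite (pk T q p) // eqxx in qp.
by rewrite big_seq big1 // => p /nS /negPf ->.
Qed.

Definition box_count n (S : site -> bool) := #|` [fset p in box n | S p]%fset|.
(** The box [n.+1] holds every triangle with a vertex in [box n]. *)
Definition empties n (S : site -> bool) : {fset triangle} :=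
  [fset T in triangle_box n.+1 | ~~ full S T]%fset.

Lemma mem_fset_filter (K : choiceType) (A : {fset K}) (P : pred K) x :
  (x \in [fset y in A | P y]%fset) = (x \in A) && P x.
Proof. by rewrite !inE. Qed.

Lemma card_fset_filter (K : choiceType) (A : {fset K}) (P : pred K) :
  #|` [fset x in A | P x]%fset|%:Z = \sum_(x <- A) (P x)%:Z.
Proof.
rewrite card_fset_sum1 big_fset /= big_mkcond /= (big_morph Posz PoszD (erefl _)).
by apply: eq_bigr => x _; case: (P x).
Qed.

(* Each site belongs to six triangles. *)
Lemma box_count_empties n S S' : packed S -> packed S' ->
  (forall p, p \notin box n -> S p = S' p) ->
  (6 * box_count n S + #|` empties n S| =
   6 * box_count n S' + #|` empties n S'|)%N.
Proof.
move=> pk pk' out.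
suff : 6 * ((box_count n S')%:Z - (box_count n S)%:Z) =
    #|` empties n S|%:Z - #|` empties n S'|%:Z by lia.
rewrite /box_count /empties !card_fset_filter -!sumrB.
pose h p : int := (S' p)%:Z - (S p)%:Z.
transitivity (\sum_(T <- triangle_box n.+1) \sum_(p <- vertices T) h p); last first.
  apply: eq_bigr => T _; rewrite /h sumrB -!full_count //.
  by case: (full S T); case: (full S' T).
have h0 p : p \notin box n -> h p = 0 by move=> /out; rewrite /h => ->; rewrite subrr.
rewrite sum_triangle_box.
have e (o : site) : -1 <= o.1 <= 1 -> -1 <= o.2 <= 1 ->
  \sum_(p <- box n.+1) h (p + o) = \sum_(p <- box n) h p.
  by move=> o1 o2; exact: sum_box_shift.
have e00 := e (0, 0) isT isT; have e11 := e (1, 1) isT isT.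
have e10 := e (1, 0) isT isT; have e01 := e (0, 1) isT isT.
transitivity (\sum_(p <- box n) h p *+ 6); first by rewrite sumrMnl mulr_natl sumrB.
(* One copy of the sum for each of the six vertex offsets: (0,0), (1,0), (0,1) in upright triangles
   and (1,1), (1,0), (0,1) in inverted ones. *)
rewrite sumrMnl !mulrS mulr0n addr0 -{1}e00 -{1}e11 -{1}e10 -{1}e01 -{1}e10 -e01.
rewrite -!big_split /=.
apply: eq_bigr => -[x y] _; rewrite /= !big_cons !big_nil.
have E (a b c d : int) : ((a, b) : site) + (c, d) = (a + c, b + d) by [].
by rewrite !E !addr0; ring.
Qed.

(** * Contours under a ground-state boundary condition *)

Section boundary.
Variables (n : nat) (b : 'Z_3) (S : site -> bool).
Hypothesis pk : packed S.
Hypothesis cov : covering S.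
Hypothesis bd : forall p, p \notin box n -> S p = (class p == b).

Let E := empties n S.
(** One layer more than for [E], to include left neighbours. *)
Let F := triangle_box n.+2.

Lemma full_outside T : (forall p, p \in vertices T -> p \notin box n) ->
  full S T /\ tau S T = b.
Proof.
move=> h; have [p pT pb] := class_surj T b.
have Sp : S p by rewrite bd ?h // pb.
by split; [apply/hasP; exists p | rewrite (tau_occ pk pT Sp)].
Qed.

Lemma empty_inside T : ~~ full S T -> has [in box n] (vertices T).
Proof.
by apply: contraR => /hasPn /full_outside[].
Qed.

Lemma in_empties T : (T \in E) = ~~ full S T.
Proof.
rewrite /E /empties mem_fset_filter andb_idl // => /empty_inside /hasP[p].
case: T => [[x y] u] pT; rewrite /= !inE in pT.
by rewrite in_triangle_box; case: u pT => /or3P[] /eqP ->; rewrite /= !in_box; lia.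
Qed.

Lemma empties_F T : T \in E -> (T \in F) && (left_of T \in F).
Proof.
rewrite in_empties => /empty_inside /hasP[p].
case: T => [[x y] u] pT; rewrite /= !inE in pT.
by case: u pT => /= /or3P[] /eqP ->; rewrite !in_triangle_box !in_box; lia.
Qed.

Section one_contour.
Variable A : triangle.
Hypothesis AE : A \in E.
Let g := contour E A.
Let f := potential S g F.
Let S' := surgery S g f (- f A).

Let g_sub T : T \in g -> T \in E. Proof. by rewrite in_contour => /andP[]. Qed.

Let gF T : T \in g -> (T \in F) && (left_of T \in F).
Proof. by move=> /g_sub /empties_F. Qed.

Let g_empty T : T \in g -> ~~ full S T.
Proof. by move=> /g_sub; rewrite in_empties. Qed.

Let g_closed T T' : T \in g -> ~~ full S T' -> touching T T' -> T' \in g.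
Proof. by rewrite -in_empties; exact: contour_closed. Qed.

(** Members of [g] are empty and have the default [tau] 0, so the potential does not change between
    touching members. *)
Let f_const T : T \in g -> f T = f A.
Proof.
apply: (contour_connected AE (contour_self AE) (P := fun T => f T = f A)) => //.
move=> X Y Xg Yg eX /touchingP[p Xp Yp]; rewrite -eX.
have := potential_star pk gF g_closed Xp Yp.
rewrite !(tau_empty (g_empty _)) // => /eqP.
by rewrite !if_same !subr0 => /eqP.
Qed.

(** Comparison with a member of [g] in the same star fixes the constant; hence [- f A] is the ground
    state to fill in. *)
Let f_touched p T : touched g p -> T \in star p -> tau S T = f T - f A.
Proof.
move=> t Tp; case/hasP: (t) => X Xp Xg.
have := potential_star pk gF g_closed Tp Xp.
rewrite t (tau_empty (g_empty Xg)) subr0 -!/(f _) (f_const Xg) => <-.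
by rewrite opprB addrC subrK.
Qed.

Let f_untouched p T T' : ~~ touched g p -> T \in star p -> T' \in star p ->
  f T = f T'.
Proof.
move=> t Tp T'p; have := potential_star pk gF g_closed Tp T'p.
by rewrite (negPf t) !subr0.
Qed.

Let packed' : packed S'.
Proof. exact: surgery_packed. Qed.

Let covering' : covering S'.
Proof. exact: surgery_covering. Qed.

Let outer p T : p \in vertices T -> T \notin g -> f T = 0 -> S' p = S p.
Proof.
move=> pT Tg fT; have := surgery_shift pk g_closed f_touched f_untouched Tg pT.
by rewrite fT /phase_shift eqxx addr0.
Qed.

(** A site outside the box has a triangle whose ray to the right or to the left misses [g]; there
    the potential is 0 and nothing moves. *)
Let boundary' p : p \notin box n -> S' p = (class p == b).
Proof.
move=> pn; rewrite -(bd pn).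
have right T : (forall T', T' \in g -> ~~ ray T T') -> T \notin g /\ f T = 0.
  move=> h; split; first by apply/negP => /h; rewrite /ray eqxx lexx.
  apply/eqP/negPn/negP => /(potential_support) [T' /h /negP h' r]; exact: h'.
have left T : (forall T', T' \in g -> ~~ ray T' T) -> T \notin g /\ f T = 0.
  move=> h; split; first by apply/negP => /h; rewrite /ray eqxx lexx.
  apply/eqP/negPn/negP => /(potential_left_support pk gF g_closed) [T' /h /negP h' r].
  exact: h'.
have inside x y u : (x, y, u) \in g -> - n%:Z - 1 <= x <= n%:Z /\ - n%:Z - 1 <= y <= n%:Z.
  move=> /g_empty/empty_inside/hasP[q qT]; rewrite !inE in qT.
  by case: u qT => /or3P[] /eqP -> /=; rewrite in_box; lia.
case: p pn => x y; rewrite in_box => pn.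
have [h|[h|[h|h]]] : n%:Z < x \/ n%:Z < y \/ y < - n%:Z \/ x < - n%:Z by lia.
- have [|Tg fT] := right (x, y, true).
    move=> [[x' y'] u'] /inside; rewrite /ray /abscissa /=; case: u' => /=; lia.
  by apply: outer Tg fT; rewrite !inE eqxx.
- have [|Tg fT] := right (x, y, true).
    move=> [[x' y'] u'] /inside; rewrite /ray /abscissa /=; case: u' => /=; lia.
  by apply: outer Tg fT; rewrite !inE eqxx.
(* For [y = - n - 1] the row [y] can still meet [g], the row [y - 1] cannot. *)
- have [|Tg fT] := right (x, y - 1, true).
    move=> [[x' y'] u'] /inside; rewrite /ray /abscissa /=; case: u' => /=; lia.
  by apply: outer Tg fT; rewrite !inE subrK eqxx !orbT.
- have [|Tg fT] := left (x - 1, y, false).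
    move=> [[x' y'] u'] /inside; rewrite /ray /abscissa /=; case: u' => /=; lia.
  by apply: outer Tg fT; rewrite !inE subrK eqxx !orbT.
Qed.

(** Every empty triangle of [S'] is a translate of a member of [E] outside [g]. *)
Let empties_drop : (#|` empties n S'| + #|` g| <= #|` E|)%N.
Proof.
have gE : (g `<=` E)%fset by apply/fsubsetP.
rewrite -(cardfsID g E) (fsetIidPr gE) addnC leq_add2l.
pose s T := translate (phase_shift (f T)) T.
have h : (#|` [fset s T | T in (E `\` g)%fset]%fset| <= #|` (E `\` g)%fset|)%N.
  exact: leq_imfset_card.
apply: leq_trans h.
apply: fsubset_leq_card; apply/fsubsetP => R; rewrite inE => /andP[_ /= nR].
have [T [Tg nT ->]] := surgery_empty pk g_closed f_touched f_untouched nR.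
by apply/imfsetP; exists T => //=; rewrite in_fsetD Tg in_empties.
Qed.

(** [box_count_empties] converts the lost empty triangles into occupied sites, six to one. *)
Lemma peierls_surgery : [/\ packed S', covering S',
  forall p, p \notin box n -> S' p = (class p == b) &
  (6 * box_count n S + #|` g| <= 6 * box_count n S')%N].
Proof.
split=> //.
have := box_count_empties pk packed' (n := n).
move=> /(_ (fun p pn => etrans (bd pn) (esym (boundary' pn)))).
by move: empties_drop; rewrite -/E; lia.
Qed.

Lemma peierls_recover p : S p =
  has (fun T => (T \notin g) && S' (p + phase_shift (f T))) (star p).
Proof. exact: surgery_recover. Qed.

End one_contour.

(** An empty triangle lies in its own contour. A full one of the wrong class needs a contour with
    nonzero potential there, since otherwise [tau] would keep its value along the row up to the
    boundary, where it is [b]; that contour has members on both sides in the row. *)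
Lemma bad_contour : ~~ (full S (0, 0, true) && (tau S (0, 0, true) == b)) ->
  exists2 A, A \in E & exists T T', [/\ T \in contour E A, T' \in contour E A,
    T.1.1 <= 0, 0 <= T'.1.1 & T'.1.2 = 0].
Proof.
set T0 := (0, 0, true); have [fT /=|nT _] := boolP (full S T0); last first.
  have TE : T0 \in E by rewrite in_empties.
  by exists T0 => //; exists T0, T0; split; rewrite ?contour_self.
move=> tb; apply: contrapT => nocl.
have h0 B : B \in E -> potential S (contour E B) F T0 = 0.
  move=> BE; apply/eqP/negPn/negP => h; apply: nocl.
  have sub T : T \in contour E B -> T \in E by rewrite in_contour => /andP[].
  have [||T Tg r] := potential_left_support pk _ _ h.
  - by move=> T /sub/empties_F.
  - by move=> T T' TB nT'; apply: contour_closed TB _; rewrite in_empties.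
  have [T' T'g r'] := potential_support h.
  exists B => //; exists T, T'; split=> //; move: r r'; rewrite /ray /abscissa /=.
  + by case: (T) => [[x y] []] /=; lia.
  + by case: (T') => [[x y] []] /=; lia.
  + by case/andP=> _ _ /andP[/eqP].
(* An even number of steps ends at an upright triangle, here outside the box. *)
have [N /(_ (maxn N n.+1).*2)] := tau_ray_constant pk in_empties empties_F h0.
have iterT k : iter k.*2 right_of T0 = (k%:Z, 0, true).
  elim: k => // k IH; rewrite doubleS !iterS IH /= intS addrC //.
rewrite iterT; have [|_ ->] := @full_outside ((maxn N n.+1)%:Z, 0, true).
  move=> p pT; rewrite !inE in pT.
  by case/or3P: pT => /eqP ->; rewrite in_box; lia.
by move=> tN; move: tb; rewrite -tN ?eqxx //; lia.
Qed.

End boundary.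

(** * Contour codes and the Peierls estimate *)

Definition ground (b : 'Z_3) : site -> bool := fun p => class p == b.

Lemma ground_mis (R : realType) b : mis_configs R (ground b).
Proof.
apply/mis_packed; split=> [T p q pT qT /eqP <- /eqP e|p].
  by apply: (class_inj pT qT).
exists (p, true); first by rewrite -mem_star up_star.
by have [q qT qb] := class_surj (p, true) b; apply/hasP; exists q => //; apply/eqP.
Qed.

Definition config_of (R : realType) S (mis : mis_configs R S) : mis_config R :=
  exist _ S (mem_set mis).

Definition ground_config (R : realType) b : mis_config R :=
  config_of (ground_mis R b).

(** The only values of [tau], besides the 0 on [g] itself, that enter horizontal jumps at [g]. *)
Definition signature (S : site -> bool) (g : {fset triangle}) :=
  [seq (tau S (right_of T), tau S (left_of T)) | T <- g].

(** Configurations with the same code have the same potential and so undergo the same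
    translations. *)
Lemma potential_signature S1 S2 (g F : {fset triangle}) :
  (forall T, T \in g -> ~~ full S1 T) -> (forall T, T \in g -> ~~ full S2 T) ->
  signature S1 g = signature S2 g -> potential S1 g F =1 potential S2 g F.
Proof.
move=> e1 e2 /eq_in_map h T; congr (- _); apply: eq_bigr => T' _.
rewrite /jump; case: ifP => // /orP[] T'g.
  rewrite (tau_empty (e1 _ T'g)) (tau_empty (e2 _ T'g)).
  by have [-> _] := h _ T'g.
rewrite (tau_empty (e1 _ T'g)) (tau_empty (e2 _ T'g)).
by have [_] := h _ T'g; rewrite right_ofK => ->.
Qed.

Lemma ler_sum_fsubset (K : choiceType) (R : realType) (A B : {fset K}) (h : K -> R) :
  (A `<=` B)%fset -> (forall x, 0 <= h x) ->
  \sum_(x <- A) h x <= \sum_(x <- B) h x.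
Proof.
move=> AB h0; rewrite [leRHS](big_fsetID _ (mem A)) /=.
have -> : [fset x in B | x \in A]%fset = A.
  by apply/fsetP => x; rewrite mem_fset_filter andb_idl //; apply/fsubsetP.
by rewrite lerDl sumr_ge0.
Qed.

Lemma geometric_bound (R : realType) N :
  \sum_(m < N) (8^-1 : R) ^+ m.+1 <= 4^-1.
Proof.
(* The extra term makes the induction close. *)
suff : \sum_(m < N) (8^-1 : R) ^+ m.+1 + (8^-1) ^+ N / 4 <= 4^-1.
  by apply: le_trans; rewrite lerDl divr_ge0 // exprn_ge0 // invr_ge0.
elim: N => [|N IH]; first by rewrite big_ord0 add0r expr0 mul1r.
rewrite big_ord_recr /=; apply: le_trans IH; rewrite -addrA lerD2l.
rewrite exprSr; have : 0 <= (8^-1 : R) ^+ N by rewrite exprn_ge0 // invr_ge0.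
by move: (_ ^+ N) => x x0; lra.
Qed.

Section finite_volume.
Variables (R : realType) (lambda : R) (n : nat) (b : 'Z_3).

Definition volume : {fset mis_config R} :=
  fset_set [set eta | agree_outside (box n) eta (ground_config R b)]%classic.

Lemma in_volume eta : (eta \in volume) =
  `[< forall p, p \notin box n -> occupied eta p = (class p == b) >].
Proof.
rewrite in_fset_set; last exact: finite_agree_outside.
by apply/idP/asboolP => [/set_mem|h]; [|apply/mem_set].
Qed.

Definition weight (eta : mis_config R) : R := lambda ^+ num_ones (box n) eta.
Definition total_weight := \sum_(eta <- volume) weight eta.

Lemma occupiedP (w : mis_config R) : packed (occupied w) /\ covering (occupied w).
Proof. by apply/mis_packed; apply: set_mem; exact: (valP w). Qed.

Definition good (w : mis_config R) :=
  full (occupied w) (0, 0, true) && (tau (occupied w) (0, 0, true) == b).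

Definition encodes (code : {fset triangle} * seq ('Z_3 * 'Z_3)) (eta : mis_config R) :=
  `[< exists2 A, A \in empties n (occupied eta) &
      code = (contour (empties n (occupied eta)) A,
        signature (occupied eta) (contour (empties n (occupied eta)) A)) >].

(** Surgery gains at least [#|g| / 6] occupied sites, hence a factor of at least [L ^ #|g|] as
    [L ^ 6 <= lambda], and it is injective on the configurations with a given code. *)
Lemma code_weight (L : R) code : 1 <= L -> L ^+ 6 <= lambda ->
  \sum_(eta <- volume | encodes code eta) weight eta * L ^+ #|` code.1| <=
  total_weight.
Proof.
move=> L1 Ll; have l1 : 1 <= lambda by apply: le_trans Ll; rewrite exprn_ege1.
case: code => g d /=.
have /choice[Phi hPhi] : forall eta, exists eta', eta \in volume ->
    encodes (g, d) eta -> [/\ eta' \in volume,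
      (6 * num_ones (box n) eta + #|` g| <= 6 * num_ones (box n) eta')%N &
      forall p, occupied eta p = has (fun T => (T \notin g) &&
        occupied eta' (p + phase_shift
          (potential (occupied eta) g (triangle_box n.+2) T))) (star p)].
  move=> eta; have [pk cov] := occupiedP eta.
  have [|] := boolP (eta \in volume); last by exists eta.
  rewrite in_volume => /asboolP bd.
  have [/asboolP[A AE [-> _]]|] := boolP (encodes (g, d) eta); last by exists eta.
  have [pk' cov' bd' count] := peierls_surgery pk cov bd AE.
  have mis' : mis_configs R _ := (mis_packed R _).2 (conj pk' cov').
  exists (config_of mis') => _ _; split=> //.
    by rewrite in_volume; apply/asboolP.
  exact: (peierls_recover pk bd AE).
pose X := [fset eta in volume | encodes (g, d) eta]%fset.
have empty eta : eta \in X -> forall T, T \in g -> ~~ full (occupied eta) T.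
  rewrite mem_fset_filter => /andP[]; rewrite in_volume => /asboolP bd.
  move=> /asboolP[A AE [-> _]] T; rewrite in_contour => /andP[+ _].
  by have [pk cov] := occupiedP eta; rewrite (in_empties pk bd).
have inj : {in X &, injective Phi}.
  move=> eta1 eta2 X1 X2 e; apply/val_inj/funext => p.
  rewrite -!/(occupied _).
  have sg : signature (occupied eta1) g = signature (occupied eta2) g.
    move: X1 X2; rewrite !mem_fset_filter.
    by move=> /andP[_ /asboolP[A1 _ [-> ->]]] /andP[_ /asboolP[A2 _ [-> ->]]].
  have pot := potential_signature (triangle_box n.+2) (empty _ X1) (empty _ X2) sg.
  move: X1 X2; rewrite !mem_fset_filter => /andP[v1 c1] /andP[v2 c2].
  have [_ _ ->] := hPhi _ v1 c1; have [_ _ ->] := hPhi _ v2 c2.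
  by rewrite e; apply: eq_has => T; rewrite pot.
rewrite big_fset_condE -/X.
apply: le_trans (_ : \sum_(eta <- X) weight (Phi eta) <= _).
  rewrite !big_seq; apply: ler_sum => eta; rewrite mem_fset_filter => /andP[v c].
  have [_ h _] := hPhi _ v c.
  have le_num : (num_ones (box n) eta <= num_ones (box n) (Phi eta))%N by lia.
  rewrite /weight -(subnKC le_num) exprD ler_wpM2l ?exprn_ge0 ?(le_trans ler01) //.
  apply: le_trans
    (_ : (L ^+ 6) ^+ (num_ones (box n) (Phi eta) - num_ones (box n) eta) <= _).
    by rewrite -exprM ler_weXn2l // mulnBr leq_subRL // leq_mul2l le_num.
  have L6 : 0 <= L ^+ 6 by rewrite exprn_ge0 // (le_trans ler01).
  apply: lerXn2r => //; rewrite nnegrE //; exact: le_trans Ll.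
apply: le_trans (_ : \sum_(eta' <- [fset Phi eta | eta in X]%fset) weight eta' <= _).
  by rewrite [leRHS]big_imfset.
apply: ler_sum_fsubset => [|eta]; last by rewrite exprn_ge0 // (le_trans ler01).
apply/fsubsetP => eta' /imfsetP[eta /=]; rewrite mem_fset_filter => /andP[v c] ->.
by have [] := hPhi _ v c.
Qed.

Lemma bad_code eta : eta \in volume -> ~~ good eta ->
  exists2 m, (m < #|` triangle_box n.+1|)%N &
  exists2 code, code \in codes m.+1 & (#|` code.1| == m.+1) && encodes code eta.
Proof.
rewrite in_volume => /asboolP bd; have [pk cov] := occupiedP eta.
move=> /(bad_contour pk bd)[A AE [T [T' [Tg T'g T0 T'0 T'y]]]].
set g := contour _ A in Tg T'g.
have g0 : (0 < #|` g|)%N by rewrite cardfs_gt0; apply/fset0Pn; exists T.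
exists #|` g|.-1.
  rewrite prednK //; apply: fsubset_leq_card; apply/fsubsetP => B.
  by rewrite in_contour => /andP[+ _]; rewrite mem_fset_filter => /andP[].
exists (g, signature (occupied eta) g); rewrite prednK //=.
  apply: (mem_codes (contour_connected AE) Tg T'g) => //.
  by rewrite size_map.
by rewrite eqxx; apply/asboolP; exists A.
Qed.

(** With [L = 8 * K], the at most [K ^ m] codes of size [m] carry a fraction of at most [8 ^- m] of
    the total weight; these sum to at most 1/4. *)
Lemma peierls_bound (K : nat) : (forall m, (size (codes m) <= K ^ m)%N) ->
  (0 < K)%N -> (8 * K%:R) ^+ 6 <= lambda ->
  \sum_(eta <- volume | ~~ good eta) weight eta <= 4^-1 * total_weight.
Proof.
move=> sz K0 Ll; set L : R := 8 * K%:R in Ll.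
have L1 : 1 <= L.
  by rewrite /L -(natrM _ 8) ler1n; lia.
have l0 : 0 <= lambda by apply: le_trans Ll; rewrite exprn_ge0 // (le_trans ler01).
have w0 eta : 0 <= weight eta by rewrite exprn_ge0.
set N := #|` triangle_box n.+1|.
(* Union bound: every bad configuration is counted at least once. *)
apply: le_trans (_ : \sum_(m < N) \sum_(code <- codes m.+1)
   \sum_(eta <- volume | (#|` code.1| == m.+1) && encodes code eta) weight eta <= _).
  pose P (m : nat) code eta := (#|` code.1| == m.+1) && encodes code eta.
  rewrite (eq_bigr (fun m : 'I_N => \sum_(eta <- volume) \sum_(code <- codes m.+1)
    (if P m code eta then weight eta else 0))); last first.
    by move=> m _; rewrite exchange_big /=; apply: eq_bigr => c _; rewrite big_mkcond.
  rewrite exchange_big /= [leLHS]big_mkcond /= !big_seq; apply: ler_sum => eta ev.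
  have t0 m : 0 <= \sum_(code <- codes m) (if P m.-1 code eta then weight eta else 0).
    by apply: sumr_ge0 => c _; case: ifP.
  case: ifP => [/(bad_code ev)[m mN [c cm Pc]]|_]; last first.
    by apply: sumr_ge0 => m _; exact: (t0 m.+1).
  rewrite (bigD1 (Ordinal mN)) //= (big_rem c) //= {1}/P Pc.
  rewrite -addrA lerDl addr_ge0 //.
    by apply: sumr_ge0 => c' _; case: ifP.
  by apply: sumr_ge0 => m' _; exact: (t0 m'.+1).
apply: le_trans (_ : \sum_(m < N) (8^-1 : R) ^+ m.+1 * total_weight <= _); last first.
  by rewrite -mulr_suml ler_wpM2r ?geometric_bound // sumr_ge0.
apply: ler_sum => m _.
apply: le_trans (_ : \sum_(code <- codes m.+1) (L ^- m.+1 * total_weight) <= _).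
  apply: ler_sum => c _; have [/eqP cm|_] := boolP (_ == _); last first.
    by rewrite big_pred0 //= mulr_ge0 ?sumr_ge0 // invr_ge0 exprn_ge0 // (le_trans ler01).
  rewrite /= ler_pdivlMl ?exprn_gt0 ?(lt_le_trans ltr01) //.
  apply: le_trans (code_weight c L1 Ll); rewrite cm mulr_sumr.
  by apply: ler_sum => eta _; rewrite mulrC.
rewrite big_const_seq count_predT iter_addr_0 -[leLHS]mulr_natr mulrAC.
rewrite ler_wpM2r ?sumr_ge0 // /L exprMn invfM exprVn -mulrA.
rewrite ler_piMr ?invr_ge0 ?exprn_ge0 // mulrC.
by rewrite ler_pdivrMr ?exprn_gt0 ?ltr0n // mul1r -natrX ler_nat.
Qed.

End finite_volume.

(** * Local events and infinite-volume limits *)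

Section ultralimits.
Variables (R : realType) (U : set_system nat).
Hypothesis UU : UltraFilter U.

(** By compactness of [0, 1] there is a cluster point, and an ultrafilter converges to its cluster
    points. *)
Lemma ultra_cvg (x : nat -> R) : (forall n, 0 <= x n <= 1) -> cvg (x @ U).
Proof.
move=> x01; have [|p [_ clp]] := @segment_compact R 0 1 (x @ U) _.
  rewrite /fmap /=; apply: filterS filterT => n _ /=.
  by rewrite in_itv /= x01.
apply: (cvgP p) => V Vp; rewrite /fmap /=.
have [//|nV] := in_ultra_setVsetC (x @^-1` V) UU.
have [y [/= nVy Vy]] := clp (~` V) V nV Vp.
by [].
Qed.

End ultralimits.

(** * The algebra of local events and its compactness *)

Section local_sets.
Variable R : realType.
Implicit Types (w : mis_config R) (A B : set (mis_config R)) (s : seq site).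

Definition agree_on s w w' := forall p, p \in s -> occupied w p = occupied w' p.

Definition depends s A := forall w w', agree_on s w w' -> A w -> A w'.

Definition local_on (D : set site) : set (set (mis_config R)) :=
  [set A | exists s, (forall p, p \in s -> D p) /\ depends s A].

Lemma agree_on_sym s w w' : agree_on s w w' -> agree_on s w' w.
Proof. by move=> h p /h. Qed.

Lemma agree_on_sub s s' w w' : {subset s <= s'} -> agree_on s' w w' ->
  agree_on s w w'.
Proof. by move=> h a p /h /a. Qed.

Lemma dependsS s s' A : {subset s <= s'} -> depends s A -> depends s' A.
Proof. by move=> h d w w' /(agree_on_sub h); apply: d. Qed.

Lemma dependsC s A : depends s A -> depends s (~` A).
Proof. by move=> d w w' /agree_on_sym a nA /(d _ _ a). Qed.

Lemma dependsI s A B : depends s A -> depends s B -> depends s (A `&` B).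
Proof. by move=> dA dB w w' a [/(dA _ _ a) ? /(dB _ _ a) ?]. Qed.

Lemma local_onI D : setI_closed (local_on D).
Proof.
move=> A B [s [sD dA]] [s' [s'D dB]]; exists (s ++ s'); split.
  by move=> p; rewrite mem_cat => /orP[/sD|/s'D].
by apply: dependsI; [apply: dependsS dA|apply: dependsS dB] => p h;
  rewrite mem_cat h ?orbT.
Qed.

Lemma local_onC D : setC_closed (local_on D).
Proof. by move=> A [s [sD dA]]; exists s; split=> //; apply: dependsC. Qed.

Lemma local_onU D : setU_closed (local_on D).
Proof.
move=> A B lA lB; rewrite -(setCK (A `|` B)) setCU.
by apply/local_onC/local_onI; apply: local_onC.
Qed.

Lemma local_on_cst D (P : Prop) : local_on D [set w | P].
Proof. by exists [::]; split=> // w w' _. Qed.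

Lemma local_on_occupied (D : set site) p : D p -> local_on D [set w | occupied w p].
Proof.
move=> Dp; exists [:: p]; split=> [q|w w' a /=]; first by rewrite inE => /eqP ->.
by rewrite (a p) // inE.
Qed.

Lemma local_onS (D D' : set site) : D `<=` D' -> local_on D `<=` local_on D'.
Proof. by move=> DD A [s [sD dA]]; exists s; split=> // p /sD /DD. Qed.

(** Overwriting the state at [p] may leave the space of maximal independent sets, so the section of
    [A] is defined by the existence of a suitable configuration. *)
Definition slice s A p b : set (mis_config R) :=
  [set w | exists w', [/\ A w', occupied w' p = b & agree_on s w w']].

Lemma depends_slice s A p b : depends s (slice s A p b).
Proof.
move=> w w' a [w1 [A1 o1 a1]]; exists w1; split=> // q qs.
by rewrite -a // a1.
Qed.

Lemma slice_split s A p : depends (p :: s) A ->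
  A = (slice s A p true `&` [set w | occupied w p]) `|`
      (slice s A p false `&` ~` [set w | occupied w p]).
Proof.
move=> dA; apply/seteqP; split=> w /=.
  move=> Aw; case e: (occupied w p); [left|right].
    by split=> //; exists w.
  by split=> //; exists w.
by case=> -[[w' [Aw' o' a]] op]; apply: dA Aw' => q;
  rewrite inE => /predU1P[->|/a //]; rewrite o'; move: op; case: (occupied w p).
Qed.

(** Induction on the sites, splitting by the state of the first; an event depending on no site is
    trivial. *)
Lemma local_on_sigma_algebra D : local_on D `<=` <<s coordinate_events D>>.
Proof.
move=> A [s [sD dA]].
have mU (X Y : set (mis_config R)) : <<s coordinate_events D>> X ->
    <<s coordinate_events D>> Y -> <<s coordinate_events D>> (X `|` Y).
  exact: (@measurableU _ (configs_on R D)).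
have mI (X Y : set (mis_config R)) : <<s coordinate_events D>> X ->
    <<s coordinate_events D>> Y -> <<s coordinate_events D>> (X `&` Y).
  exact: (@measurableI _ (configs_on R D)).
have mC (X : set (mis_config R)) : <<s coordinate_events D>> X ->
    <<s coordinate_events D>> (~` X).
  exact: (@measurableC _ (configs_on R D)).
elim: s sD A dA => [|p s IH] sD A dA.
  have [[w Aw]|nA] := pselect (exists w, A w).
    have -> : A = setT by apply/seteqP; split=> // w' _; apply: dA Aw.
    exact: (@measurableT _ (configs_on R D)).
  have -> : A = set0 by apply/seteqP; split=> // w Aw; apply: nA; exists w.
  exact: (@measurable0 _ (configs_on R D)).
have sD' q : q \in s -> D q by move=> qs; apply: sD; rewrite inE qs orbT.
have mp : <<s coordinate_events D>> [set w : mis_config R | occupied w p].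
  by apply: sub_sigma_algebra; exists p => //; apply: sD; rewrite inE eqxx.
rewrite (slice_split dA); apply: (mU); apply: (mI) => //.
- by apply: IH => //; exact: depends_slice.
- by apply: IH => //; exact: depends_slice.
- exact: mC.
Qed.

Lemma configs_on_measurable D :
  @measurable _ (configs_on R D) = <<s local_on D>>.
Proof.
apply/seteqP; split.
  by apply: sub_smallest2r => // _ [p Dp ->]; exact: local_on_occupied.
apply: smallest_sub; first exact: smallest_sigma_algebra.
exact: local_on_sigma_algebra.
Qed.

Lemma measurable_local A : local_on setT A -> measurable (A : set (configs R)).
Proof. by rewrite configs_on_measurable; exact: sub_sigma_algebra. Qed.

Definition nearby p : seq site := flatten [seq vertices T | T <- star p].

Lemma nearbyP p q :
  reflect (exists2 T, p \in vertices T & q \in vertices T) (q \in nearby p).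
Proof.
by apply: (iffP flatten_mapP) => -[T pT qT]; exists T => //;
  move: pT; rewrite mem_star.
Qed.

(** Independence and maximality at [p] involve only the sites of [nearby p]. *)
Lemma mis_of_approximations (S : site -> bool) :
  (forall p, exists w, forall q, q \in nearby p -> occupied w q = S q) ->
  mis_configs R S.
Proof.
move=> h; apply/mis_packed; split=> [T p q pT qT Sp Sq|p].
  have [w e] := h p; have [pk _] := occupiedP w.
  by apply: (pk T) => //; rewrite e //; apply/nearbyP; exists T.
have [w e] := h p; have [_ /(_ p)[T pT /hasP[q qT oq]]] := occupiedP w.
exists T => //; apply/hasP; exists q => //; rewrite -e //.
by apply/nearbyP; exists T.
Qed.

(** Otherwise choose for each [N] a point of [A] outside the first [N] sets. The pointwise
    ultrafilter limit is again a maximal independent set, lies in [A], and is in no [F k]. *)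
Lemma local_compact A (F : nat -> set (mis_config R)) : local_on setT A ->
  (forall k, local_on setT (F k)) -> A `<=` \bigcup_k F k ->
  exists N, A `<=` \big[setU/set0]_(k < N) F k.
Proof.
move=> [s [_ dA]] lF AF; apply: contrapT => n.
have /choice[w hw] : forall N, exists w, A w /\ forall k, (k < N)%N -> ~ F k w.
  move=> N; apply: contrapT => h; apply: n; exists N => w Aw.
  rewrite -bigcup_mkord; apply: contrapT => nF; apply: h; exists w; split=> // k kN Fk.
  by apply: nF; exists k.
have [U [UU subU]] := ultraFilterLemma (_ : ProperFilter (\oo : set_system nat)).
have PU : ProperFilter U := @ultra_proper _ _ UU.
have FU : Filter U := @filter_filter _ _ PU.
pose v p := `[< U [set N | occupied (w N) p] >].
have vp p : U [set N | occupied (w N) p = v p].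
  have [h|h] := in_ultra_setVsetC [set N | occupied (w N) p] UU.
    by have -> : v p = true by apply/asboolP.
  have -> : v p = false.
    apply/negP => /asboolP h'.
    by have [N []] := @filter_ex _ U PU _ (@filterI _ U FU _ _ h h').
  by apply: (@filterS _ U FU _ _ _ h) => N /negP/negPf.
have vs (t : seq site) : U [set N | forall p, p \in t -> occupied (w N) p = v p].
  elim: t => [|p t IH]; first exact: (@filterS _ U FU setT _ _ filterT).
  apply: (@filterS _ U FU _ _ _ (@filterI _ U FU _ _ (vp p) IH)) => N [/= e h] q.
  by rewrite inE => /predU1P[->|/h].
have mv : mis_configs R v.
  apply: mis_of_approximations => p.
  have [N h] := @filter_ex _ U PU _ (vs (nearby p)).
  by exists (w N).
pose W := config_of mv.
have AW : A W.
  have [N h] := @filter_ex _ U PU _ (vs s); exact: (dA (w N) W h (hw N).1).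
have [k _ FkW] := AF _ AW; have [t [_ dF]] := lF k.
have kU : U [set N | (k < N)%N] by apply: subU; exact: nbhs_infty_gt.
have [N [h kN]] := @filter_ex _ U PU _ (@filterI _ U FU _ _ (vs t) kU).
apply: ((hw N).2 k kN); apply: dF FkW => p pt; exact/esym/h.
Qed.

End local_sets.

(* A copy of [mis_config R] carrying the algebra of local sets, as input for the
   Caratheodory extension. *)
Definition local_algebra (R : realType) := mis_config R.
HB.instance Definition _ (R : realType) := Pointed.on (local_algebra R).
HB.instance Definition _ (R : realType) := isAlgebraOfSets.Build
  default_measure_display (local_algebra R)
  (@local_on_cst R setT False) (@local_onU R setT) (@local_onC R setT).

(** * The limit probability *)

Section limit_measure.
Variables (R : realType) (U : set_system nat).
Hypothesis UU : UltraFilter U.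
Let PU : ProperFilter U := @ultra_proper _ _ UU.
#[local] Existing Instance PU.
Let FU : Filter U := @filter_filter _ _ PU.
#[local] Existing Instance FU.
Variable P : nat -> set (mis_config R) -> R.
Hypothesis P_ge0 : forall n A, 0 <= P n A.
Hypothesis P_total : forall n, P n setT = 1.
Hypothesis P_add : forall n A B, A `&` B = set0 -> P n (A `|` B) = P n A + P n B.

Let P01 n A : 0 <= P n A <= 1.
Proof.
rewrite P_ge0 -(P_total n) -(setUCr A) P_add ?lerDl ?P_ge0 //; exact: setICr.
Qed.

Definition ultra_content (A : set (local_algebra R)) : R := lim (P ^~ A @ U).

Lemma ultra_content_cvg A : P ^~ A @ U --> ultra_content A.
Proof. by apply: ultra_cvg => n; exact: P01. Qed.

Let P0 n : P n set0 = 0.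
Proof.
have : P n (set0 `|` set0) = P n set0 + P n set0 by rewrite P_add // set0I.
by rewrite setU0 => /eqP; rewrite -subr_eq subrr => /eqP <-.
Qed.

Definition ultra_contentE (A : set (local_algebra R)) : \bar R := (ultra_content A)%:E.

Let ge0 A : (0 <= ultra_contentE A)%E.
Proof.
rewrite lee_fin; apply: limr_ge; first by apply: cvgP; exact: ultra_content_cvg.
by apply: (@filterS _ U FU setT _ _ filterT) => n _; exact: P_ge0.
Qed.

Let semi_add : measure_function.semi_additive ultra_contentE.
Proof.
move=> F n _ tF _; rewrite /ultra_contentE sumEFin; congr (_%:E).
have e k : P k (\big[setU/set0]_(i < n) F i) = \sum_(i < n) P k (F i).
  elim: n => [|n IH]; first by rewrite !big_ord0 P0.
  rewrite !big_ord_recr /= P_add ?IH // -bigcup_mkord -subset0 => w [[i /= ni Fi] Fn].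
  by have := tF i n I I (ex_intro _ w (conj Fi Fn)) => ein; rewrite ein ltnn in ni.
have c m : (fun k => \sum_(i < m) P k (F i)) @ U -->
    \sum_(i < m) ultra_content (F i).
  elim: m => [|m IH].
    rewrite big_ord0 (_ : (fun k => _) = cst 0); first exact: cvg_cst.
    by apply/funext => k; rewrite big_ord0.
  rewrite big_ord_recr /= (_ : (fun k => _) =
    (fun k => \sum_(i < m) P k (F i)) + P ^~ (F m)).
    by apply: cvgD => //; exact: ultra_content_cvg.
  by apply/funext => k; rewrite big_ord_recr.
apply: cvg_lim => //; rewrite (_ : P ^~ _ = fun k => \sum_(i < n) P k (F i)) //.
by apply/funext.
Qed.

HB.instance Definition _ := isContent.Build _ _ _ ultra_contentE ge0 semi_add.

(** [local_compact] reduces a countable cover to a finite one. *)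
Let sigma_sub : measurable_subset_sigma_subadditive ultra_contentE.
Proof.
move=> A F mF mA AF; have [N AN] := local_compact mA mF AF.
have := content_subadditive [the content _ _ of ultra_contentE] (fun k _ => mF k) mA AN.
move/le_trans; apply.
rewrite -(big_mkord xpredT (fun k => ultra_contentE (F k))).
by apply: nneseries_lim_ge => n _ _; exact: ge0.
Qed.

HB.instance Definition _ := Content_SigmaSubAdditive_isMeasure.Build
  _ _ _ ultra_contentE sigma_sub.

Definition limit_measure (A : set (configs R)) : \bar R :=
  measure_extension ultra_contentE A.

Let limit_measure0 : limit_measure set0 = 0%E.
Proof. exact: (measure0 (measure_extension ultra_contentE)). Qed.

Let limit_measure_ge0 A : (0 <= limit_measure A)%E.
Proof. exact: (measure_ge0 (measure_extension ultra_contentE)). Qed.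

Let limit_measure_sigma : semi_sigma_additive limit_measure.
Proof.
move=> F mF tF mUF.
have m X : measurable (X : set (configs R)) -> <<s local_on setT >> X.
  by rewrite configs_on_measurable.
apply: (@measure_semi_sigma_additive _ _ _ (measure_extension ultra_contentE)) => //.
  by move=> k; exact: m.
exact: m.
Qed.

HB.instance Definition _ := isMeasure.Build _ _ _ limit_measure
  limit_measure0 limit_measure_ge0 limit_measure_sigma.

Lemma limit_measure_local A : local_on setT A ->
  limit_measure A = (ultra_content A)%:E.
Proof. by move=> lA; rewrite /limit_measure /measure_extension measurable_mu_extE. Qed.

Let limit_measureT : limit_measure setT = 1%E.
Proof.
rewrite limit_measure_local; last exact: (@local_on_cst R setT True).
congr (_%:E); apply: cvg_lim => //.
by rewrite (_ : P ^~ setT = cst 1); [exact: cvg_cst | apply/funext].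
Qed.

HB.instance Definition _ := Measure_isProbability.Build _ _ _ limit_measure
  limit_measureT.

Lemma limit_probability : exists mu : probability (configs R) R,
  forall A, local_on setT A -> exists2 r : R, P ^~ A @ U --> r & mu A = r%:E.
Proof.
exists limit_measure => A lA; exists (ultra_content A).
  exact: ultra_content_cvg.
exact: limit_measure_local.
Qed.

End limit_measure.

(** * Gibbs kernels *)

Lemma fin_addeI (R : realType) (a x y : \bar R) : a \is a fin_num ->
  (a + x = a + y)%E -> x = y.
Proof.
move=> fa e; have := congr1 (fun z => z - a)%E e.
by rewrite ![(a + _)%E]addeC !addeK.
Qed.

Section specification.
Variables (R : realType) (L : {fset site}).
Implicit Types (w eta : mis_config R) (A B : set (mis_config R)) (s : seq site).

Definition compatible w : {fset mis_config R} :=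
  fset_set [set eta | agree_outside L eta w].

Lemma in_compatible eta w :
  (eta \in compatible w) = `[< agree_outside L eta w >].
Proof.
rewrite in_fset_set; last exact: finite_agree_outside.
by apply/idP/asboolP => [/set_mem|h]; [|apply/mem_set].
Qed.

Lemma agree_outside_sym eta w : agree_outside L eta w -> agree_outside L w eta.
Proof. by move=> h p /h. Qed.

Lemma agree_outside_trans w1 w2 w3 : agree_outside L w1 w2 ->
  agree_outside L w2 w3 -> agree_outside L w1 w3.
Proof. by move=> h1 h2 p pL; rewrite h1 ?h2. Qed.

(* The sites outside [L] whose state influences which patterns inside [L] are
   allowed. *)
Definition collar : seq site :=
  [seq q <- flatten [seq nearby p | p <- flatten [seq nearby l | l <- L]]
     | q \notin L].

Definition outer s : seq site := collar ++ [seq q <- s | q \notin L].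

Lemma outer_outside s p : p \in outer s -> p \notin L.
Proof. by rewrite mem_cat => /orP[]; rewrite mem_filter => /andP[]. Qed.

Lemma in_collar l p q : l \in L -> l \in nearby p -> q \in nearby p ->
  q \notin L -> q \in collar.
Proof.
move=> lL /nearbyP[T pT lT] qp qL; rewrite mem_filter qL.
apply/flatten_mapP; exists p => //; apply/flatten_mapP; exists l => //.
by apply/nearbyP; exists T.
Qed.

(** Use [eta] in [L] and [w'] outside. A neighbourhood meeting [L] sees only [eta], by agreement on
    the collar; any other sees only [w']. *)
Lemma splice s w w' eta : agree_on (outer s) w w' -> agree_outside L eta w ->
  exists eta', agree_outside L eta' w' /\ agree_on (L ++ s) eta eta'.
Proof.
move=> a o.
pose S p := if p \in L then occupied eta p else occupied w' p.
have mis : mis_configs R S.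
  apply: mis_of_approximations => p.
  have [/hasP[l lp lL]|/hasPn nL] := boolP (has [in L] (nearby p)).
    exists eta => q qp; rewrite /S; case: ifPn => // qL.
    by rewrite o // a // mem_cat (in_collar lL lp qp qL).
  by exists w' => q qp; rewrite /S (negPf (nL q qp)).
exists (config_of mis); split=> p; first by move=> pL; rewrite /occupied /= /S (negPf pL).
rewrite mem_cat => ps; rewrite {2}/occupied /= /S; case: ifPn ps => // pL /=.
by move=> ps; rewrite o // a // mem_cat [X in _ || X]mem_filter pL ps orbT.
Qed.

Lemma agree_outside_inj w1 w2 : agree_outside L w1 w2 -> agree_on L w1 w2 ->
  w1 = w2.
Proof.
move=> o i; apply/val_inj/funext => p.
by have [pL|pL] := boolP (p \in L); [exact: i | exact: o].
Qed.

(** Splicing is a bijection between the two sets of compatible configurations and preserves [h]. *)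
Lemma sum_compatible s w w' (h : mis_config R -> R) :
  agree_on (outer s) w w' ->
  (forall eta eta', agree_on (L ++ s) eta eta' -> h eta = h eta') ->
  \sum_(eta <- compatible w) h eta = \sum_(eta <- compatible w') h eta.
Proof.
move=> a hh.
have /choice[Phi hPhi] : forall eta, exists eta', agree_outside L eta w ->
    agree_outside L eta' w' /\ agree_on (L ++ s) eta eta'.
  move=> eta; have [ow|n] := pselect (agree_outside L eta w); last by exists eta.
  by have [eta' ?] := splice a ow; exists eta'.
have onL eta eta' : agree_on (L ++ s) eta eta' -> agree_on L eta eta'.
  by apply: agree_on_sub => p pL; rewrite mem_cat pL.
have inj : {in compatible w &, injective Phi}.
  move=> eta1 eta2; rewrite !in_compatible => /asboolP o1 /asboolP o2 e.
  apply: agree_outside_inj.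
    exact: agree_outside_trans o1 (agree_outside_sym o2).
  move=> p pL; rewrite (onL _ _ (hPhi _ o1).2) // (onL _ _ (hPhi _ o2).2) //.
  by rewrite e.
have -> : compatible w' = [fset Phi eta | eta in compatible w]%fset.
  apply/fsetP => eta'; rewrite in_compatible; apply/asboolP/imfsetP => /=; last first.
    by case=> eta; rewrite in_compatible => /asboolP /hPhi[ow _] ->.
  move=> o'; have [eta [ow e]] := splice (agree_on_sym a) o'.
  exists eta; first by rewrite in_compatible; apply/asboolP.
  have [wo1 e1] := hPhi _ ow; apply: agree_outside_inj.
    exact: agree_outside_trans o' (agree_outside_sym wo1).
  by move=> p pL; rewrite (onL _ _ e) // (onL _ _ e1).
rewrite big_imfset //= !big_seq; apply: eq_bigr => eta.
by rewrite in_compatible => /asboolP /hPhi[_ /hh].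
Qed.

Lemma num_ones_agree eta eta' : agree_on L eta eta' ->
  num_ones L eta = num_ones L eta'.
Proof.
move=> a; rewrite /num_ones; congr (size (enum_fset _)); apply/fsetP => p.
by rewrite !mem_fset_filter; case: (boolP (p \in L)) => //= pL; rewrite a.
Qed.

Variable lambda : R.
Hypothesis lambda_gt0 : 0 < lambda.

Lemma partition_functionE w :
  partition_function lambda L w = \sum_(eta <- compatible w) lambda ^+ num_ones L eta.
Proof. by rewrite /partition_function fsbig_finite //; exact: finite_agree_outside. Qed.

Lemma partition_function_gt0 w : 0 < partition_function lambda L w.
Proof.
have ww : w \in compatible w by rewrite in_compatible; apply/asboolP.
rewrite partition_functionE (big_fsetD1 w) //=.
by rewrite ltr_pwDl ?exprn_gt0 // sumr_ge0 // => eta _; rewrite exprn_ge0 // ltW.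
Qed.

Definition gibbs_weight w eta : R :=
  lambda ^+ num_ones L eta / partition_function lambda L w.

Lemma gibbs_weight_ge0 w eta : 0 <= gibbs_weight w eta.
Proof. by rewrite divr_ge0 ?exprn_ge0 ?ltW // partition_function_gt0. Qed.

Definition gibbs_prob w A : R :=
  \sum_(eta <- compatible w) gibbs_weight w eta * (eta \in A)%:R.

(** A finite mixture of Dirac masses, built from library measures to inherit their structure. *)
Definition gibbs_measure w : set (configs R) -> \bar R :=
  msum (fun i => mscale (NngNum (gibbs_weight_ge0 w (nth w (compatible w) i)))
                        \d_(nth w (compatible w) i : configs R)) (size (compatible w)).
HB.instance Definition _ w := Measure.on (gibbs_measure w).

Lemma gibbs_measureE w A : gibbs_measure w A = (gibbs_prob w A)%:E.
Proof.
rewrite /gibbs_measure /gibbs_prob /msum (big_nth w) big_mkord -sumEFin.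
by apply: eq_bigr => i _; rewrite /= /mscale /= diracE EFinM.
Qed.

Lemma gibbs_prob_ge0 w A : 0 <= gibbs_prob w A.
Proof. by apply: sumr_ge0 => eta _; rewrite mulr_ge0 ?gibbs_weight_ge0. Qed.

Lemma gibbs_probT w : gibbs_prob w setT = 1.
Proof.
rewrite /gibbs_prob (eq_bigr (gibbs_weight w)) => [|eta _]; last by rewrite in_setT mulr1.
by rewrite -mulr_suml -partition_functionE mulfV // gt_eqF // partition_function_gt0.
Qed.

(** Locality of the specification: on a local event it depends on finitely many sites outside
    [L]. *)
Lemma gibbs_prob_agree s A w w' : depends s A -> agree_on (outer s) w w' ->
  gibbs_prob w A = gibbs_prob w' A.
Proof.
move=> dA a; rewrite /gibbs_prob /gibbs_weight.
have onL eta eta' : agree_on (L ++ s) eta eta' -> agree_on L eta eta'.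
  by apply: agree_on_sub => p pL; rewrite mem_cat pL.
have -> : partition_function lambda L w = partition_function lambda L w'.
  rewrite !partition_functionE; apply: (sum_compatible a) => eta eta' /onL h.
  by rewrite (num_ones_agree h).
apply: (sum_compatible a) => eta eta' h; rewrite (num_ones_agree (onL _ _ h)).
congr (_ * _%:R); congr nat_of_bool.
have hs : agree_on s eta eta' by apply: agree_on_sub h => p ps; rewrite mem_cat ps orbT.
by apply/idP/idP => /set_mem h'; apply/mem_set;
  [apply: dA h' | apply: dA (agree_on_sym hs) h'].
Qed.

Lemma gibbs_measure_set1 w eta : gibbs_measure w [set eta] =
  if `[< agree_outside L eta w >]
  then (lambda ^+ num_ones L eta / partition_function lambda L w)%:E else 0%E.
Proof.
rewrite gibbs_measureE -in_compatible /gibbs_prob; case: ifPn => [ec|nec].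
  rewrite (big_fsetD1 eta) //= mem_set // mulr1 big1_seq ?addr0 // => eta'.
  rewrite in_fsetD1 => /andP[_ /andP[ne _]].
  by rewrite (_ : (_ \in _) = false) ?mulr0 //; apply/negP => /set_mem/eqP; apply/negP.
rewrite big1_seq // => eta' /andP[_ e'c].
rewrite (_ : (_ \in _) = false) ?mulr0 //; apply/negP => /set_mem e.
by move: nec; rewrite -e e'c.
Qed.

Lemma gibbs_probC w A : gibbs_prob w (~` A) = 1 - gibbs_prob w A.
Proof.
rewrite -(gibbs_probT w) /gibbs_prob -sumrB; apply: eq_bigr => eta _.
rewrite -mulrBr in_setT in_setC; congr (_ * _).
by case: (eta \in A); rewrite ?subrr ?subr0.
Qed.

(** Local events have local preimages by [gibbs_prob_agree], and Dynkin's lemma does the rest. A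
    general [D] serves both the kernel and integration over [configs R]. *)
Lemma measurable_gibbs_measure (D : set site) (V : set (configs R)) :
  ~` [set` L] `<=` D -> measurable V ->
  @measurable_fun _ _ (configs_on R D) (\bar R) setT (fun w => gibbs_measure w V).
Proof.
move=> LD; rewrite configs_on_measurable; move: V.
apply: (dynkin_induction (configs_on_measurable R setT) (@local_onI R setT)).
- rewrite (_ : (fun w => _) = cst 1%E); first exact: measurable_cst.
  by apply/funext => w; rewrite gibbs_measureE gibbs_probT.
- move=> A [s [_ dA]] _ Y _; rewrite setTI configs_on_measurable.
  apply: sub_sigma_algebra; exists (outer s); split.
    by move=> p /outer_outside pL; apply: LD => /=; apply/negP.
  by move=> w w' a; rewrite /preimage /= !gibbs_measureE (gibbs_prob_agree dA a).
- move=> A mA mf.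
  rewrite (_ : (fun w => _) = (cst 1 \- (fun w => gibbs_measure w A))%E).
    by apply: emeasurable_funB => //; exact: measurable_cst.
  by apply/funext => w; rewrite /= !gibbs_measureE gibbs_probC EFinB.
- move=> F mF tF mf.
  rewrite (_ : (fun w => _) =
    (fun w => \sum_(k <oo | k \in predT) gibbs_measure w (F k)))%E.
    by apply: ge0_emeasurable_sum => // k w _ _; exact: measure_ge0.
  by apply/funext => w; rewrite measure_semi_bigcup //; exact: bigcupT_measurable.
Qed.

Definition gibbs_kernel :
  configs_on R (~` [set` L]) -> {measure set (configs R) -> \bar R} := gibbs_measure.

Let gibbs_kernel_measurable (V : set (configs R)) : measurable V ->
  measurable_fun setT (gibbs_kernel ^~ V).
Proof. exact: measurable_gibbs_measure. Qed.

HB.instance Definition _ := isKernel.Build _ _ (configs_on R (~` [set` L]))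
  (configs R) R gibbs_kernel gibbs_kernel_measurable.

Let gibbs_kernelT w : gibbs_kernel w setT = 1%E.
Proof. by rewrite -(gibbs_probT w) -gibbs_measureE. Qed.

HB.instance Definition _ := Kernel_isProbability.Build _ _
  (configs_on R (~` [set` L])) (configs R) R gibbs_kernel gibbs_kernelT.

(** * From local events to the full conditional law *)

Section conditional.
Local Open Scope ereal_scope.
Variable mu : probability (configs R) R.
Hypothesis local_law : forall A B, local_on setT A -> local_on (~` [set` L]) B ->
  \int[mu]_(w in (B : set (configs R))) gibbs_measure w A = mu (A `&` B).

Let measurable_sub (B : set (configs_on R (~` [set` L]))) : measurable B ->
  measurable (B : set (configs R)).
Proof.
rewrite !configs_on_measurable; by apply: sub_smallest2r => //; apply: local_onS.
Qed.

Let mf (V : set (configs R)) (B : set (configs R)) : measurable V ->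
  measurable B -> @measurable_fun _ _ (configs R) (\bar R) B (fun w => gibbs_measure w V).
Proof.
move=> mV mB; apply: (measurable_funS (E := setT)) => //.
exact: measurable_gibbs_measure.
Qed.

(** First extension, in [B] with [A] local. For complements the identity on the whole space is used,
    and the finite mass of [A] in [B] is cancelled. *)
Let law_outside A B : local_on setT A -> <<s local_on (~` [set` L]) >> B ->
  \int[mu]_(w in (B : set (configs R))) gibbs_measure w A = mu (A `&` B).
Proof.
move=> lA; have mA := measurable_local lA; move: B.
apply: (dynkin_induction (configs_on_measurable R _) (@local_onI R (~` [set` L]))).
- exact: (local_law lA (@local_on_cst R _ True)).
- by move=> B; exact: local_law.
- move=> B /measurable_sub mB eB; have mCB := measurableC mB.
  have e : \int[mu]_(w in (B `|` ~` B)) gibbs_measure w A =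
      mu (A `&` B) + mu (A `&` ~` B).
    rewrite setUCr (local_law lA (@local_on_cst R _ True)).
    rewrite -measureU ?setIid -?setIUr ?setUCr //; try exact: measurableI.
    by rewrite setIACA setICr setI0.
  have d : [disjoint B & ~` B]%classic by exact/disj_setPCl.
  have m : @measurable_fun _ _ (configs R) (\bar R) (B `|` ~` B)
      (fun w => gibbs_measure w A) by rewrite setUCr; exact: mf.
  move: e; rewrite ge0_integral_setU // eB; apply: fin_addeI.
  by apply: fin_num_measure; exact: measurableI.
- move=> F mF tF eF.
  have mF' k : measurable (F k : set (configs R)) by exact: measurable_sub.
  rewrite ge0_integral_bigcup //; last first.
    by apply: mf => //; exact: bigcupT_measurable.
  rewrite setI_bigcupr measure_semi_bigcup //.
  + by apply: eq_eseriesr => k _; exact: eF.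
  + by move=> k; exact: measurableI.
  + exact: trivIset_setIl.
  + by apply: bigcupT_measurable => k; exact: measurableI.
Qed.

(** Second extension, in [A] with [B] fixed. *)
Lemma gibbs_conditional_law : conditional_law mu gibbs_kernel.
Proof.
move=> A B mA mB; have mB' := measurable_sub mB.
rewrite configs_on_measurable in mB; move: mA.
rewrite configs_on_measurable; move: A.
apply: (dynkin_induction (configs_on_measurable R setT) (@local_onI R setT)).
- by apply: law_outside => //; exact: (@local_on_cst R _ True).
- by move=> A lA; exact: law_outside.
- move=> A mA eA; have mCA := measurableC mA.
  have e : \int[mu]_(w in (B : set (configs R)))
      (gibbs_measure w A + gibbs_measure w (~` A)) =
      mu (A `&` B) + mu (~` A `&` B).
    rewrite -measureU ?setIUl; try exact: measurableI; last first.
      by rewrite setIACA setICr set0I.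
    rewrite -setIUl setUCr.
    have h := law_outside (A := setT) (@local_on_cst R setT True) mB.
    apply: etrans h.
    apply: eq_integral => w _.
    by rewrite !gibbs_measureE gibbs_probC gibbs_probT -EFinD addrC subrK.
  move: e; rewrite ge0_integralD //; try exact: mf.
  rewrite eA; apply: fin_addeI.
  by apply: fin_num_measure; exact: measurableI.
- move=> F mF tF eF.
  rewrite (eq_integral
    (fun w : configs R => \sum_(k <oo) gibbs_measure w (F k))); last first.
    by move=> w _; rewrite measure_semi_bigcup //; exact: bigcupT_measurable.
  rewrite integral_nneseries //; last by move=> k; exact: mf.
  rewrite setI_bigcupl measure_semi_bigcup //.
  + by apply: eq_eseriesr => k _; exact: eF.
  + by move=> k; exact: measurableI.
  + exact: trivIset_setIr.
  + by apply: bigcupT_measurable => k; exact: measurableI.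
Qed.

End conditional.

End specification.

(** * Phase coexistence *)

Section finite_volume_gibbs.
Variables (R : realType) (lambda : R) (b : 'Z_3).
Hypothesis lambda_gt0 : 0 < lambda.
Implicit Types (w eta : mis_config R) (A B : set (mis_config R)) (n : nat).

Lemma total_weight_gt0 n : 0 < total_weight lambda n b.
Proof.
have gv : ground_config R b \in volume R n b.
  by rewrite in_volume; apply/asboolP.
rewrite /total_weight (big_fsetD1 _ gv) /=.
by rewrite ltr_pwDl ?exprn_gt0 // sumr_ge0 // => eta _; rewrite exprn_ge0 // ltW.
Qed.

Definition mean n (h : mis_config R -> R) : R :=
  (\sum_(eta <- volume R n b) weight lambda n eta * h eta) / total_weight lambda n b.

Definition box_prob n A : R := mean n (fun w => (w \in A)%:R).

Lemma mean_ge0 n h : (forall w, 0 <= h w) -> 0 <= mean n h.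
Proof.
move=> h0; apply: divr_ge0; last exact/ltW/total_weight_gt0.
by apply: sumr_ge0 => eta _; rewrite mulr_ge0 // exprn_ge0 // ltW.
Qed.

Lemma meanD n h1 h2 : mean n (fun w => h1 w + h2 w) = mean n h1 + mean n h2.
Proof.
rewrite /mean -mulrDl -big_split /=; congr (_ / _).
by apply: eq_bigr => eta _; rewrite mulrDr.
Qed.

Lemma meanZ n c h : mean n (fun w => c * h w) = c * mean n h.
Proof.
rewrite /mean mulrA mulr_sumr; congr (_ / _).
by apply: eq_bigr => eta _; rewrite mulrCA.
Qed.

Lemma eq_mean n h1 h2 : h1 =1 h2 -> mean n h1 = mean n h2.
Proof. by move=> /funext ->. Qed.

Lemma box_prob_ge0 n A : 0 <= box_prob n A.
Proof. exact: mean_ge0. Qed.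

Lemma box_probT n : box_prob n setT = 1.
Proof.
rewrite /box_prob /mean (eq_bigr (weight lambda n)) => [|eta _]; last first.
  by rewrite in_setT mulr1.
by rewrite mulfV // gt_eqF // total_weight_gt0.
Qed.

Lemma box_prob_add n A B : A `&` B = set0 ->
  box_prob n (A `|` B) = box_prob n A + box_prob n B.
Proof.
move=> AB0; rewrite -meanD; apply: eq_mean => w; rewrite in_setU.
have : ~ (w \in A /\ w \in B).
  by move=> [/set_mem wA /set_mem wB]; rewrite -[False]/(set0 w) -AB0.
by case: (w \in A); case: (w \in B); rewrite ?addr0 ?add0r //= => -[].
Qed.

(** Both configurations have the same number of ones in the box outside [L]. *)
Lemma num_ones_box (L : {fset site}) n w eta : (forall p, p \in L -> p \in box n) ->
  agree_outside L eta w ->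
  (num_ones (box n) w + num_ones L eta = num_ones (box n) eta + num_ones L w)%N.
Proof.
move=> LB a.
have split_box (v : mis_config R) : num_ones (box n) v =
    (num_ones L v + #|` [fset p in (box n `\` L) | occupied v p]|)%N%fset.
  rewrite /num_ones -cardfsUI.
  have -> : ([fset p in L | occupied v p] `&`
      [fset p in (box n `\` L) | occupied v p])%fset = fset0.
    apply/fsetP => p; rewrite !inE.
    by case: (p \in L); rewrite //= !andbF.
  rewrite cardfs0 addn0; congr (size (enum_fset _)); apply/fsetP => p.
  rewrite in_fsetU !mem_fset_filter in_fsetD.
  by case: (boolP (p \in L)) => [/LB ->|_] /=; rewrite ?orbF.
have -> : num_ones (box n) w =
    (num_ones L w + #|` [fset p in (box n `\` L) | occupied eta p]|)%N%fset.
  rewrite split_box; congr (_ + size (enum_fset _))%N; apply/fsetP => p.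
  rewrite !mem_fset_filter in_fsetD.
  by case: (boolP (p \in L)) => //= pL; rewrite a.
by rewrite split_box; lia.
Qed.

(** Changes inside [L] keep the boundary condition, as [L] lies in the box. *)
Lemma sum_volume_compatible (L : {fset site}) n w (h : mis_config R -> R) :
  (forall p, p \in L -> p \in box n) -> w \in volume R n b ->
  \sum_(eta <- volume R n b | eta \in compatible L w) h eta =
  \sum_(eta <- compatible L w) h eta.
Proof.
move=> LB wv; rewrite big_fset_condE /=; congr bigop.body; congr enum_fset.
apply/fsetP => eta; rewrite mem_fset_filter andb_idl // in_compatible => /asboolP a.
move: wv; rewrite !in_volume => /asboolP bd; apply/asboolP => p pB.
by rewrite a ?bd //; apply: contra pB => /LB.
Qed.

Lemma compatible_eq (L : {fset site}) eta w : agree_outside L eta w ->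
  compatible L eta = compatible L w.
Proof.
move=> a; apply/fsetP => v; rewrite !in_compatible.
apply/asboolP/asboolP => h; first exact: agree_outside_trans h a.
exact: agree_outside_trans h (agree_outside_sym a).
Qed.

(* Detailed balance: [weight w * gibbs_weight w eta] is symmetric in [w], [eta]. *)
Lemma finite_dlr (L : {fset site}) n A B : (forall p, p \in L -> p \in box n) ->
  (forall w eta, agree_outside L eta w -> B w -> B eta) ->
  mean n (fun w => gibbs_prob L lambda w A * (w \in B)%:R) = box_prob n (A `&` B).
Proof.
move=> LB cB; rewrite /box_prob /mean; congr (_ / _).
have memB w eta : agree_outside L eta w -> (w \in B) = (eta \in B).
  move=> a; apply/idP/idP => /set_mem h; apply/mem_set; first exact: cB h.
  exact: cB (agree_outside_sym a) h.
transitivity (\sum_(w <- volume R n b) \sum_(eta <- volume R n b)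
   (if eta \in compatible L w then
     weight lambda n w * (w \in B)%:R *
       (gibbs_weight L lambda w eta * (eta \in A)%:R) else 0)).
  rewrite !big_seq; apply: eq_bigr => w wv.
  rewrite -big_mkcond /= sum_volume_compatible // -mulr_sumr /gibbs_prob -mulrA.
  by congr (_ * _); rewrite mulrC.
rewrite exchange_big /= !big_seq; apply: eq_bigr => eta ev.
transitivity (\sum_(w <- compatible L eta)
   weight lambda n eta * (eta \in A `&` B)%:R * gibbs_weight L lambda eta w).
  rewrite -(sum_volume_compatible _ LB ev) [RHS]big_mkcond /=; apply: eq_bigr => w _.
  rewrite !in_compatible; have [a|na] := pselect (agree_outside L eta w); last first.
    rewrite !asboolF // => a; apply: na; exact: agree_outside_sym.
  rewrite !asboolT //; last exact: agree_outside_sym.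
  rewrite (memB _ _ a) in_setI /gibbs_weight !partition_functionE (compatible_eq a).
  have := congr1 (fun k => lambda ^+ k) (num_ones_box LB a).
  rewrite /weight !exprD => e.
  case: (eta \in A); case: (eta \in B); rewrite /= ?mulr1 ?mulr0 ?mul0r //.
  by rewrite !mulrA e.
rewrite -mulr_sumr -mulr_suml -partition_functionE mulfV ?mulr1 //.
by rewrite gt_eqF // partition_function_gt0.
Qed.

End finite_volume_gibbs.

(** * The Gibbs property of the limit *)

Section infinite_volume.
Variables (R : realType) (lambda : R) (b : 'Z_3) (U : set_system nat).
Hypothesis lambda_gt0 : 0 < lambda.
Hypothesis UU : UltraFilter U.
Hypothesis subU : \oo `<=` U.
Let PU : ProperFilter U := @ultra_proper _ _ UU.
#[local] Existing Instance PU.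
Let FU : Filter U := @filter_filter _ _ PU.
#[local] Existing Instance FU.
Variable mu : probability (configs R) R.
Hypothesis mu_lim : forall A, local_on setT A ->
  exists2 r : R, (fun n => box_prob lambda b n A) @ U --> r & mu A = r%:E.
Implicit Types (w : mis_config R) (A B : set (mis_config R)) (s : seq site).

Definition local_function s (h : mis_config R -> R) :=
  forall w w', agree_on s w w' -> h w = h w'.

Lemma measurable_local_function s h (B : set (configs R)) : local_function s h ->
  measurable B -> @measurable_fun _ _ (configs R) (\bar R) B (fun w => (h w)%:E).
Proof.
move=> hs mB; apply: (measurable_funS (E := setT)) => // _ Y _; rewrite setTI.
apply: measurable_local; exists s; split=> // w w' a; rewrite /preimage /=.
by rewrite (hs _ _ a).
Qed.

(** [h'] evaluates [h] at any configuration agreeing on [s] with state [c] at [p], and is 0 if there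
    is none. *)
Lemma local_function_slice p s h c : (forall w, 0 <= h w) ->
  local_function (p :: s) h ->
  exists h', [/\ forall w, 0 <= h' w, local_function s h' &
    forall w, occupied w p = c -> h w = h' w].
Proof.
move=> h0 hs.
pose P w w' := occupied w' p = c /\ agree_on s w w'.
have Ph w w1 w2 : P w w1 -> P w w2 -> h w1 = h w2.
  move=> [c1 a1] [c2 a2]; apply: hs => q; rewrite inE => /predU1P[->|qs].
    by rewrite c1.
  by rewrite -a1 // a2.
pose h' w := if pselect (exists w', P w w') is left e then h (projT1 (cid e)) else 0.
exists h'; split.
- by move=> w; rewrite /h'; case: pselect.
- move=> w w' a; rewrite /h'.
  have PP w1 : P w w1 <-> P w' w1.
    by split=> -[c1 a1]; split=> // q qs; rewrite -a1 // a.
  case: pselect => [e|n]; case: pselect => [e'|n'] //.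
  + apply: (Ph w); first exact: projT2 (cid e).
    exact/PP/(projT2 (cid e')).
  + by case: n'; case: e => w1 /PP; exists w1.
  + by case: n; case: e' => w1 /PP; exists w1.
- move=> w wc; rewrite /h'; have Pw : P w w by [].
  by case: pselect => [e|[]]; [apply: (Ph w) Pw (projT2 (cid e)) | exists w].
Qed.

(** Convergence passes from events to local functions by splitting on the state of one site at a
    time, until the function is constant. *)
Lemma local_integral s h B : (forall w, 0 <= h w) -> local_function s h ->
  local_on setT B ->
  exists2 r : R, (fun n => mean lambda b n (fun w => h w * (w \in B)%:R)) @ U --> r &
    (\int[mu]_(w in (B : set (configs R))) (h w)%:E)%E = r%:E.
Proof.
elim: s h B => [|p s IH] h B h0 hs lB.
  have [r br er] := mu_lim lB.
  pose c := h (point : mis_config R).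
  have hc w : h w = c by apply: hs.
  exists (c * r).
    rewrite (_ : (fun n => _) = (fun n => c * box_prob lambda b n B)).
      by apply: cvgM => //; exact: cvg_cst.
    by apply/funext => n; rewrite -meanZ; apply: eq_mean => w; rewrite hc.
  rewrite EFinM -er -integral_cst; last exact: measurable_local.
  by apply: eq_integral => w _; rewrite hc.
have lp : local_on setT [set w : mis_config R | occupied w p].
  exact: local_on_occupied.
have [h1 [h10 h1s h1e]] := local_function_slice true h0 hs.
have [h2 [h20 h2s h2e]] := local_function_slice false h0 hs.
pose B1 := B `&` [set w | occupied w p].
pose B2 := B `&` ~` [set w | occupied w p].
have lB1 : local_on setT B1 by exact: local_onI.
have lB2 : local_on setT B2 by apply: local_onI => //; exact: local_onC.
have [r1 c1 e1] := IH h1 B1 h10 h1s lB1.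
have [r2 c2 e2] := IH h2 B2 h20 h2s lB2.
have e w : w \in B1 -> h w = h1 w by move=> /set_mem[_ /= wp]; exact: h1e.
have e' w : w \in B2 -> h w = h2 w.
  by move=> /set_mem[_ /= /negP/negPf wp]; exact: h2e.
exists (r1 + r2).
  rewrite (_ : (fun n => _) = (fun n => mean lambda b n (fun w => h1 w * (w \in B1)%:R)) +
     (fun n => mean lambda b n (fun w => h2 w * (w \in B2)%:R))).
    exact: cvgD.
  apply/funext => n; rewrite fctE -meanD; apply: eq_mean => w.
  have [wB|wB] := boolP (w \in B); last first.
    have -> : (w \in B1) = false by apply/negP => /set_mem[Bw _]; rewrite mem_set in wB.
    have -> : (w \in B2) = false by apply/negP => /set_mem[Bw _]; rewrite mem_set in wB.
    by rewrite !mulr0 addr0.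
  have [wp|wp] := boolP (occupied w p).
    have w1 : w \in B1 by apply/mem_set; split=> //; exact: set_mem.
    have -> : (w \in B2) = false by apply/negP => /set_mem[_ /(_ wp)].
    by rewrite w1 mulr0 addr0 e.
  have w2 : w \in B2 by apply/mem_set; split; [exact: set_mem|exact/negP].
  have -> : (w \in B1) = false by apply/negP => /set_mem[_ /=]; apply/negP.
  by rewrite w2 mulr0 add0r e'.
have BE : B = B1 `|` B2 by rewrite -setIUr setUCr setIT.
have mB1 := measurable_local lB1; have mB2 := measurable_local lB2.
rewrite [X in integral _ X _]BE ge0_integral_setU //.
- rewrite EFinD -e1 -e2; congr (_ + _)%E; apply: eq_integral => w wB.
    by rewrite e.
  by rewrite e'.
- by apply: (measurable_local_function hs); exact: measurableU.
- by move=> w _; rewrite lee_fin.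
- by apply/disj_set2P; rewrite setIACA setICr setI0.
Qed.

(** By [finite_dlr] the identity is exact in every box containing [L], and both sides converge along
    [U]. *)
Lemma local_dlr (L : {fset site}) A B : local_on setT A ->
  local_on (~` [set` L]) B ->
  (\int[mu]_(w in (B : set (configs R))) gibbs_measure L lambda_gt0 w A)%E =
  mu (A `&` B).
Proof.
move=> [s [_ dA]] lB; have lB' : local_on setT B by apply: local_onS lB.
have hs : local_function (outer L s) (fun w => gibbs_prob L lambda w A).
  by move=> w w'; exact: gibbs_prob_agree.
have [r c e] := local_integral (fun w => gibbs_prob_ge0 L lambda_gt0 w A) hs lB'.
have lAB : local_on setT (A `&` B) by apply: local_onI => //; exists s.
have [r' c' e'] := mu_lim lAB.
rewrite (eq_integral (fun w : configs R => (gibbs_prob L lambda w A)%:E)); last first.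
  by move=> w _; rewrite gibbs_measureE.
rewrite e e'; congr (_%:E).
have [N hN] : exists N, forall p, p \in L -> p \in box N.
  pose m (p : site) := (absz p.1 + absz p.2)%N.
  exists (\sum_(p <- L) m p)%N => p pL.
  have : (m p <= \sum_(p <- L) m p)%N by rewrite (big_fsetD1 p) //= leq_addr.
  move: (\sum_(p <- L) m p)%N => k; case: p {pL} => x y; rewrite /m /= in_box; lia.
have near : U [set n | mean lambda b n (fun w => gibbs_prob L lambda w A * (w \in B)%:R) =
    box_prob lambda b n (A `&` B)].
  apply: (@filterS _ U FU [set n | (N <= n)%N]); last first.
    by apply: subU; exact: nbhs_infty_ge.
  move=> n /= Nn; apply: finite_dlr => //.
    move=> [x y] /hN; rewrite !in_box; lia.
  move=> w eta a Bw; case: lB => t [tL dB]; apply: dB Bw => p pt.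
  by rewrite a //; apply/negP; exact: tL.
have c2 : (fun n => box_prob lambda b n (A `&` B)) @ U --> r.
  by apply: cvg_trans c; apply: near_eq_cvg.
by rewrite -(cvg_lim (@Rhausdorff R) c2) (cvg_lim (@Rhausdorff R) c').
Qed.

Lemma limit_gibbs : maximal_hardcore_gibbs lambda mu.
Proof.
move=> L; exists [the R.-pker _ ~> _ of gibbs_kernel (L := L) lambda_gt0].
  by apply: gibbs_conditional_law => A B; exact: local_dlr.
by apply: aeW => w eta; exact: gibbs_measure_set1.
Qed.

End infinite_volume.

Lemma gibbs_limit_exists (R : realType) (lambda : R) (b : 'Z_3) : 0 < lambda ->
  exists2 mu : probability (configs R) R, maximal_hardcore_gibbs lambda mu &
  forall A c, local_on setT A -> (forall n, box_prob lambda b n A <= c) ->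
    (mu A <= c%:E)%E.
Proof.
move=> l0.
have [U [UU subU]] := ultraFilterLemma (_ : ProperFilter (\oo : set_system nat)).
have [mu hmu] := limit_probability UU (box_prob_ge0 b l0) (box_probT b l0)
  (box_prob_add lambda b).
have PU : ProperFilter U := @ultra_proper _ _ UU.
have FU : Filter U := @filter_filter _ _ PU.
exists mu; first exact: (limit_gibbs l0 UU subU hmu).
move=> A c lA hc; have [r cr ->] := hmu A lA; rewrite lee_fin.
by apply: (cvgr_to_le cr); apply: (@filterS _ U FU setT _ _ filterT) => n _; exact: hc.
Qed.

Lemma box_prob_bad (R : realType) (lambda : R) b n (A : set (mis_config R)) :
  0 < lambda ->
  \sum_(eta <- volume R n b | ~~ good b eta) weight lambda n eta <=
    4^-1 * total_weight lambda n b ->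
  (forall w : mis_config R, A w -> ~~ good b w) ->
  box_prob lambda b n A <= 4^-1.
Proof.
move=> l0 hb hA; rewrite /box_prob /mean ler_pdivrMr ?total_weight_gt0 //.
apply: le_trans hb; rewrite [leRHS]big_mkcond /=; apply: ler_sum => eta _.
have [/set_mem /hA ->|_] := boolP (eta \in A); first by rewrite mulr1.
by rewrite mulr0; case: ifP => // _; rewrite exprn_ge0 // ltW.
Qed.

Lemma good_origin (R : realType) b (w : mis_config R) : good b w ->
  occupied w (0, 0) = (0 == b).
Proof.
case/andP=> f /eqP tb; have [pk _] := occupiedP w.
by rewrite (occ_tau pk f (p := (0, 0))) ?tb.
Qed.

Theorem theorem1 (R : realType) :
  exists2 lambda0 : R, 0 < lambda0 &
    forall lambda : R, lambda0 < lambda ->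
      exists mu1 mu2 : probability (configs R) R,
        [/\ maximal_hardcore_gibbs lambda mu1,
            maximal_hardcore_gibbs lambda mu2 &
            exists2 A : set (configs R), measurable A & mu1 A <> mu2 A].
Proof.
have [K hK] := size_codes.
(* Passing to [K.+1] makes the base positive. *)
have hK' m : (size (codes m) <= K.+1 ^ m)%N.
  by apply: leq_trans (hK m) _; case: m => // m; rewrite leq_exp2r.
exists ((8 * K.+1%:R) ^+ 6); first by rewrite exprn_gt0 // mulr_gt0.
move=> lambda hl.
have l0 : 0 < lambda by apply: lt_trans hl; rewrite exprn_gt0 // mulr_gt0.
have bound b n := peierls_bound n b hK' (ltn0Sn K) (ltW hl).
(* The origin has class 0, so it is occupied in the ground state 0 and empty in the ground state
   1. *)
have [mu1 g1 lim1] := gibbs_limit_exists 0 l0.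
have [mu2 g2 lim2] := gibbs_limit_exists 1 l0.
pose A : set (mis_config R) := [set w | occupied w (0, 0)].
have lA : local_on setT A by exact: local_on_occupied.
have mA : measurable (A : set (configs R)) by exact: measurable_local.
exists mu1, mu2; split=> //; exists A => // e.
(* Under either boundary condition the atypical state of the origin has probability at most 1/4;
   equal measures of [A] would give 1 <= 1/2. *)
have h1 : (mu1 (~` A) <= (4^-1)%:E)%E.
  apply: lim1 => [|n]; first exact: local_onC.
  apply: box_prob_bad (bound _ _) _ => // w nw.
  by apply/negP => /good_origin ow; apply: nw; rewrite /A /= ow.
have h2 : (mu2 A <= (4^-1)%:E)%E.
  apply: lim2 => // n; apply: box_prob_bad (bound _ _) _ => // w Aw.
  by apply/negP => /good_origin; rewrite Aw.
have hT : (mu1 A + mu1 (~` A) = 1)%E.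
  rewrite -measureU //; [|exact: measurableC|exact: setICr].
  by rewrite setUCr; exact: probability_setT.
have : (mu1 A + mu1 (~` A) <= (4^-1)%:E + (4^-1)%:E)%E by rewrite e; exact: leeD.
by rewrite hT -EFinD lee_fin; lra.
Qed.
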